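(* Let $n\ge 1$, let $P_1,\ldots,P_n$ be distinct points of the plane $\mathbb{R}^2$, let $N=\mathbb{R}^2\setminus\{P_1,\ldots,P_n\}$, and fix pairwise disjoint rays $r_1,\ldots,r_n$ such that $r_i$ starts at $P_i$. The map that sends the homotopy class (in $N$) of a closed polygonal line $l$ in $N$, where the representative $l$ is chosen so that all the rays $r_1,\ldots,r_n$ are in general position with respect to $l$, to the economical form of the cyclic Poincaré word of $l$ with respect to $r_1,\ldots,r_n$ is a well-defined one-to-one correspondence (bijection) between the set of homotopy classes of closed polygonal lines in $N$ and the set $E_{n,c}$ of economical cyclic words in the letters $a_1,\ldots,a_n,a_1^{-1},\ldots,a_n^{-1}$.
   Context: A closed (oriented) polygonal line in the plane is a finite nonempty sequence $A_1\ldots A_m$ of points of $\mathbb{R}^2$ (its vertices, not necessarily distinct), considered up to cyclic shift. It is a closed polygonal line in $N\subset\mathbb{R}^2$ if all segments $A_1A_2,\ldots,A_{m-1}A_m,A_mA_1$ are contained in $N$ (for $m=1$ this means $A_1\in N$). An elementary cancellation in $N$ of a closed polygonal line in $N$ with at least two vertices is the removal of one vertex $B$ such that, for the vertices $A,C$ adjacent to $B$ in the cyclic sequence (not necessarily distinct), the convex hull of $A,B,C$ is contained in $N$. A (piecewise linear) homotopy in $N$ is a finite sequence of closed polygonal lines in $N$ in which, of any two consecutive polygonal lines, one is obtained from the other by an elementary cancellation in $N$. Two closed polygonal lines are homotopic in $N$ if there is a homotopy in $N$ whose first and last polygonal lines are the given ones; homotopy classes are the classes of this equivalence relation. A ray is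 in general position with respect to a closed polygonal line $l$ if it does not pass through any vertex of $l$. The sign of the intersection point of an oriented segment $\overrightarrow{AB}$ of $l$ with a ray starting at a point $C$ and in general position with respect to $l$ is $+1$ if the triangle $ABC$ is oriented clockwise, and $-1$ otherwise. Cyclic Poincaré word of $l$ (with respect to pairwise disjoint rays $r_1,\ldots,r_n$ in general position with respect to $l$): moving along $l$ in its direction, at every intersection of an oriented segment of $l$ with $r_i$ write $a_i$ if the sign of the intersection is $+1$ and $a_i^{-1}$ if it is $-1$. The resulting (possibly empty) oriented cyclic word, i.e. a finite word up to cyclic shift, is the cyclic Poincaré word. An elementary cancellation of a cyclic word in the letters $a_i,a_i^{-1}$ is the replacement of one of the (cyclic) subwords $a_ia_i^{-1},a_i^{-1}a_i$ by the empty subword. A cyclic word is economical if it has none of these subwords (the empty word is economical). The economical form of a cyclic word is the unique economical cyclic word obtained from it by elementary cancellations. *)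

(* Defs.v *)
From HB Require Import structures.
From mathcomp Require Import all_boot all_order all_algebra.
From mathcomp Require Import boolp classical_sets functions reals.
Set Implicit Arguments.
Unset Strict Implicit.
Unset Printing Implicit Defensive.
Import Order.TTheory GRing.Theory Num.Theory.
Local Open Scope classical_set_scope.
Local Open Scope quotient_scope.
Local Open Scope ring_scope.

Section Cyclic.
Context {T : choiceType}.
Implicit Types s t : seq T.

Definition shift_eq : rel (seq T) :=
  fun s t => [exists k : 'I_(size s).+1, rot k s == t].

Lemma shift_eqP s t : reflect (exists k, rot k s = t) (shift_eq s t).
Proof.
apply: (iffP existsP) => [[k /eqP <-]|[k <-]]; first by exists k.
have [lek|/ltnW gek] := leqP k (size s); first by exists (Ordinal (lek : (k < _.+1)%N)).
by exists ord0; rewrite rot0 rot_oversize.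
Qed.

Lemma shift_eq_refl : reflexive shift_eq.
Proof. by move=> s; apply/shift_eqP; exists 0%N; rewrite rot0. Qed.

Lemma shift_eq_sym : symmetric shift_eq.
Proof.
have imp s t : shift_eq s t -> shift_eq t s.
  case/shift_eqP=> k <-; apply/shift_eqP.
  by exists (size (rot k s) - k)%N; rewrite -/(rotr k (rot k s)) rotK.
by move=> s t; apply/idP/idP; exact: imp.
Qed.

Lemma shift_eq_trans : transitive shift_eq.
Proof.
move=> t s u /shift_eqP[k <-] /shift_eqP[m <-]; apply/shift_eqP.
by rewrite rot_rot_add; eexists.
Qed.

Definition shift_equiv := EquivRel shift_eq shift_eq_refl shift_eq_sym shift_eq_trans.

End Cyclic.

Definition cyclic (T : choiceType) := {eq_quot @shift_equiv T}.
HB.instance Definition _ (T : choiceType) := Choice.on (cyclic T).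

Definition cyc {T : choiceType} (s : seq T) : cyclic T := \pi_(cyclic T) s.
Definition cyc_repr {T : choiceType} (c : cyclic T) : seq T := repr c.

Lemma cyc_reprK (T : choiceType) (c : cyclic T) : cyc (cyc_repr c) = c.
Proof. exact: reprK. Qed.

Lemma cyc_eqP (T : choiceType) (s t : seq T) :
  cyc s = cyc t <-> exists k, rot k s = t.
Proof. by split => [/eqmodP/shift_eqP|/shift_eqP h] //; apply/eqmodP. Qed.

Lemma cyc_repr_rot (T : choiceType) (s : seq T) : exists k, rot k s = cyc_repr (cyc s).
Proof. by apply/cyc_eqP; rewrite cyc_reprK. Qed.

(* The consecutive pairs (A_1, A_2), ..., (A_m, A_1). *)
Definition cyclic_pairs (T : Type) (s : seq T) : seq (T * T) := zip s (rot 1 s).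

Lemma rot_cyclic_pairs (T : Type) k (s : seq T) :
  cyclic_pairs (rot k s) = rot k (cyclic_pairs s).
Proof.
have zip_rot (t u : seq T) : size t = size u -> zip (rot k t) (rot k u) = rot k (zip t u).
  move=> tu; rewrite /rot zip_cat ?size_drop ?tu //; congr (_ ++ _).
    by elim: k t u tu => [|k ih] [|x t] [|y u] //= [tu]; rewrite ih.
  by elim: k t u tu => [|k ih] [|x t] [|y u] //= [tu]; rewrite ih.
by rewrite /cyclic_pairs rot_rot zip_rot // size_rot.
Qed.

Section Plane.
Context {R : realType}.
Local Notation point := 'rV[R]_2.
Implicit Types (A B C X : point) (N S : set point) (s : seq point).

Definition cross (u v : point) : R := u 0 0 * v 0 1 - u 0 1 * v 0 0.

Definition clockwise A B C : Prop := cross (B - A) (C - A) < 0.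

Definition segment A B : set point :=
  [set X | exists t : R, 0 <= t <= 1 /\ X = A + t *: (B - A)].

Definition triangle_hull A B C : set point :=
  [set X | exists a b c : R, [/\ 0 <= a, 0 <= b, 0 <= c, a + b + c = 1
     & X = a *: A + b *: B + c *: C]].

Definition is_ray C S : Prop :=
  exists v : point, v != 0 /\ S = [set X | exists t : R, 0 <= t /\ X = C + t *: v].

(* For a single vertex A the only cyclic pair is (A, A), and the condition    *)
(* says that A is in N.                                                       *)
Definition polyline_in N s : Prop :=
  s != [::] /\ forall e, e \in cyclic_pairs s -> segment e.1 e.2 `<=` N.

Lemma polyline_in_cyc N s : polyline_in N (cyc_repr (cyc s)) <-> polyline_in N s.
Proof.
have [k <-] := cyc_repr_rot s.
rewrite /polyline_in rot_cyclic_pairs -!size_eq0 size_rot.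
by split=> -[? h]; split=> // e; move: (h e); rewrite mem_rot.
Qed.

Definition polyline N : Type :=
  {l : cyclic point | `[< polyline_in N (cyc_repr l) >]}.
HB.instance Definition _ N := Choice.on (polyline N).

Definition vertices N (l : polyline N) : seq point := cyc_repr (\val l).

Lemma mem_vertices N (l : polyline N) s : \val l = cyc s -> vertices l =i s.
Proof. by rewrite /vertices => -> A; have [k <-] := cyc_repr_rot s; rewrite mem_rot. Qed.

(* The vertex B is removed; its neighbours are C and the last vertex of the   *)
(* sequence C :: s, which is C itself if only two vertices are present.       *)
Definition line_cancel N : rel (polyline N) := fun l l' =>
  `[< exists B C s, [/\ \val l = cyc (B :: C :: s), \val l' = cyc (C :: s)
       & triangle_hull (last C s) B C `<=` N] >].

Definition homotopy_step N : rel (polyline N) := fun l l' =>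
  line_cancel l l' || line_cancel l' l.

Definition homotopic N : rel (polyline N) := fun l l' =>
  `[< exists h : seq (polyline N), path (@homotopy_step N) l h /\ last l h = l' >].

Lemma homotopy_step_sym N : symmetric (@homotopy_step N).
Proof. by move=> l l'; rewrite /homotopy_step orbC. Qed.

Lemma homotopic_refl N : reflexive (@homotopic N).
Proof. by move=> l; apply/asboolP; exists [::]. Qed.

Lemma homotopic_sym N : symmetric (@homotopic N).
Proof.
have imp l l' : @homotopic N l l' -> homotopic l' l.
  move=> /asboolP[h [lh <-]]; apply/asboolP; exists (rev (belast l h)); split.
    by rewrite rev_path (eq_path (e' := @homotopy_step N)) // => x y; exact: homotopy_step_sym.
  by case: h {lh} => //= x h; rewrite rev_cons last_rcons.
by move=> l l'; apply/idP/idP; exact: imp.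
Qed.

Lemma homotopic_trans N : transitive (@homotopic N).
Proof.
move=> l' l l'' /asboolP[h [lh <-]] /asboolP[k [lk <-]]; apply/asboolP.
by exists (h ++ k); rewrite cat_path lh lk last_cat.
Qed.

Definition homotopic_equiv N :=
  EquivRel (@homotopic N) (@homotopic_refl N) (@homotopic_sym N) (@homotopic_trans N).

Definition homotopy_class N := {eq_quot homotopic_equiv N}.

Definition class_of N (l : polyline N) : homotopy_class N :=
  \pi_(homotopy_class N) l.

Lemma class_of_eqP N (l l' : polyline N) :
  class_of l = class_of l' <-> homotopic l l'.
Proof. by split => [/eqmodP|h] //; apply/eqmodP. Qed.

End Plane.

(* The letter (i, true) stands for a_i, and (i, false) for its inverse.       *)
Definition letter (n : nat) : choiceType := ('I_n * bool)%type.
Definition inv_letter n (x : letter n) : letter n := (x.1, ~~ x.2).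

Section Words.
Context {n : nat}.
Implicit Types (v w : cyclic (letter n)).

Definition word_cancel : rel (cyclic (letter n)) := fun w w' =>
  `[< exists x s, w = cyc (x :: inv_letter x :: s) /\ w' = cyc s >].

Definition economical w : Prop :=
  ~ exists x s, w = cyc (x :: inv_letter x :: s).

Definition economical_form w v : Prop :=
  (exists h, path word_cancel w h /\ last w h = v) /\ economical v.

End Words.

Definition economical_words n : set (cyclic (letter n)) := [set w | economical w].

Section PoincareWord.
Context {R : realType} {n : nat}.
Local Notation point := 'rV[R]_2.
Variables (P : 'I_n -> point) (r : 'I_n -> set point).

Definition general_position N (l : polyline N) : Prop :=
  forall i A, A \in vertices l -> ~ r i A.

(* A ray r i which contains neither A nor B and whose origin is not on the    *)
(* segment AB meets that segment in at most one point, and disjoint rays meet *)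
(* it in different points. So in the situation where these definitions are    *)
(* used the parameter chosen by xget is the only one, and no two rays are     *)
(* crossed at the same time.                                                  *)
Definition crossing_time (A B : point) (i : 'I_n) : R :=
  xget 0 [set t : R | 0 <= t <= 1 /\ r i (A + t *: (B - A))].

Definition crossings (A B : point) : seq 'I_n :=
  sort (fun i j => crossing_time A B i <= crossing_time A B j)
    [seq i <- enum 'I_n | `[< segment A B `&` r i !=set0 >]].

Definition segment_word (A B : point) : seq (letter n) :=
  [seq (i, `[< clockwise A B (P i) >]) | i <- crossings A B].

Definition seq_word (s : seq point) : seq (letter n) :=
  flatten [seq segment_word e.1 e.2 | e <- cyclic_pairs s].

Definition poincare_word N (l : polyline N) : cyclic (letter n) :=
  cyc (seq_word (vertices l)).

(* The choice of a starting vertex is irrelevant.                             *)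
Lemma cyc_seq_word s t : cyc s = cyc t -> cyc (seq_word s) = cyc (seq_word t).
Proof.
move=> /cyc_eqP[k <-]; apply/cyc_eqP.
rewrite /seq_word rot_cyclic_pairs map_rot; set ss := map _ _.
exists (size (flatten (take k ss))).
by rewrite -{2}(cat_take_drop k ss) flatten_cat rot_size_cat /rot flatten_cat.
Qed.

Lemma poincare_wordE N (l : polyline N) s :
  \val l = cyc s -> poincare_word l = cyc (seq_word s).
Proof. by move=> ls; apply: cyc_seq_word; rewrite -ls cyc_reprK. Qed.

End PoincareWord.

(* Main.v *)
(* Write F for the free group on a_1, ..., a_n.

   Every segment of N, in general position or not, gets a word: cut the plane
   along the lines carrying the rays and count the points of these lines as
   lying on a fixed side. In a triangle contained in N the rays are disjoint
   chords, so the words of its sides have the form p q, q^-1 r and p r. Hence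
   the class of the word in F is a homotopy invariant of paths, and its
   conjugacy class one of closed polygonal lines.

   Choose coordinates in which the P_i have distinct abscissas, and a base point
   O below all of them. Pushing a path down to the horizontal line through O,
   over the top of the points P_i that are in the way, shows that each loop at O
   is homotopic to a product of standard loops g_1, ..., g_n, one around each
   P_i. Sending a_i to the Poincare word of g_i is an endomorphism phi of F. It
   is onto: the complement of the rays is path connected, because a crossing
   of r_i is avoided by following r_i back to P_i, so there is a loop at O that
   crosses r_i once and no other ray. As F is Hopfian, phi is injective. So
   closed polygonal lines whose words are conjugate are homotopic, and
   every conjugacy class is attained. Finally, conjugate economical cyclic words
   are equal. *)
Require Import Defs.
From HB Require Import structures.
From mathcomp Require Import all_boot all_order all_algebra all_fingroup ring lra.
From mathcomp Require Import boolp classical_sets functions reals.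
Set Implicit Arguments.
Unset Strict Implicit.
Unset Printing Implicit Defensive.
Import Order.TTheory GRing.Theory Num.Theory.

(** * Free and cyclic reduction of words *)

(** The rays may point in any direction, so one ray can run through the standard loops of many other
    sites, and the word of [g_i] depends on the whole arrangement. The Hopf property replaces its
    computation: nothing about [phi] is used except that it is onto, which needs only one loop per
    ray. The convention on the lines carrying the rays lets the vertices of intermediate lines of a
    homotopy lie on rays, and degenerate triangles are treated like all others, so homotopies never
    have to be perturbed; only single closed lines are, in order to compare [cut_word] with the
    Poincare word. The free group is not constructed: its elements are words, compared through the
    normal form [red], and conjugacy is [conj_words]. *)

Lemma cyc_cat (T : choiceType) (s t : seq T) : cyc (s ++ t) = cyc (t ++ s).
Proof. by apply/cyc_eqP; exists (size s); rewrite rot_size_cat. Qed.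

Section FreeWords.
Context {n : nat}.
Implicit Types (x y : letter n) (u v w g : seq (letter n)).

Lemma inv_letterK : involutive (@inv_letter n).
Proof. by case=> i b; rewrite /inv_letter /= negbK. Qed.

Definition inv_word w := rev (map (@inv_letter n) w).

Lemma inv_wordK : involutive inv_word.
Proof.
by move=> w; rewrite /inv_word map_rev revK -map_comp map_id_in // => x _; exact: inv_letterK.
Qed.

Lemma inv_word_cat u v : inv_word (u ++ v) = inv_word v ++ inv_word u.
Proof. by rewrite /inv_word map_cat rev_cat. Qed.

Definition reduced w := sorted (fun x y => y != inv_letter x) w.

Definition push x w :=
  if w is y :: w' then if y == inv_letter x then w' else x :: w else [:: x].

Definition red w := foldr push [::] w.

Lemma reduced_behead x w : reduced (x :: w) -> reduced w.
Proof. by case: w => //= y w /andP[]. Qed.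

Lemma push_reduced x w : reduced w -> reduced (push x w).
Proof.
case: w => //= y w hw; case: eqP => [_|/eqP ne]; last by rewrite /= ne.
exact: reduced_behead hw.
Qed.

Lemma red_reduced w : reduced (red w).
Proof. by elim: w => //= x w; exact: push_reduced. Qed.

(** Van der Waerden's trick: mutually inverse letters act on reduced words by mutually inverse maps.
    Uniqueness of the reduced form follows without a confluence argument. *)
Lemma pushK x w : reduced w -> push x (push (inv_letter x) w) = w.
Proof.
case: w => [_|y w hw] /=; first by rewrite eqxx.
rewrite inv_letterK; case: (y =P x) => [<-|_]; last by rewrite /= eqxx.
by case: w hw => //= z w /andP[/negPf-> _].
Qed.

Lemma red_id w : reduced w -> red w = w.
Proof.
elim: w => //= x w ih hw; rewrite ih; last exact: reduced_behead hw.
by case: w hw {ih} => //= y w /andP[/negPf-> _].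
Qed.

Lemma foldr_push_red u w : reduced w -> foldr push w (red u) = foldr push w u.
Proof.
move=> hw.
have red_foldr v : reduced (foldr push w v) by elim: v => //= x v; exact: push_reduced.
elim: u => //= x u <-; case: (red u) => //= y s.
by case: eqP => // ->; rewrite pushK.
Qed.

Lemma red_catl u v : red (red u ++ v) = red (u ++ v).
Proof. by rewrite /red !foldr_cat foldr_push_red // red_reduced. Qed.

Lemma red_catr u v : red (u ++ red v) = red (u ++ v).
Proof. by rewrite /red !foldr_cat -/(red _) red_id ?red_reduced. Qed.

Lemma red_cat u u' v v' : red u = red u' -> red v = red v' -> red (u ++ v) = red (u' ++ v').
Proof. by move=> eu ev; rewrite -red_catl -red_catr eu ev red_catl red_catr. Qed.

Lemma red_cancel u x v : red (u ++ x :: inv_letter x :: v) = red (u ++ v).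
Proof. by rewrite -red_catr -[in RHS]red_catr /= pushK // red_reduced. Qed.

Lemma red_mulV u v : red (u ++ inv_word u ++ v) = red v.
Proof.
elim: u v => //= x u ih v; rewrite /inv_word map_cons rev_cons -cats1 -!catA /=.
rewrite -[push _ _]/(red ([:: x] ++ _)) -red_catr ih red_catr.
exact: (red_cancel [::]).
Qed.

Lemma red_Vmul u v : red (inv_word u ++ u ++ v) = red v.
Proof. by rewrite -{2}(inv_wordK u) red_mulV. Qed.

Lemma red_injl u v w : red (u ++ v) = red (u ++ w) -> red v = red w.
Proof. by move=> h; rewrite -(red_Vmul u v) -(red_Vmul u w); exact: red_cat. Qed.

Lemma red_inv_word u v : red u = red v -> red (inv_word u) = red (inv_word v).
Proof.
move=> h; apply: (@red_injl v); rewrite -[v ++ inv_word v]cats0 -catA red_mulV.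
have -> : red (v ++ inv_word u) = red (u ++ inv_word u) by apply: red_cat.
by rewrite -[u ++ _]cats0 -catA red_mulV.
Qed.

Lemma reduced_inv_word w : reduced (inv_word w) = reduced w.
Proof.
rewrite /reduced rev_sorted sorted_map; apply: eq_sorted => x y /=.
by rewrite (inj_eq (can_inj inv_letterK)) eq_sym (can2_eq inv_letterK inv_letterK).
Qed.

Definition conj_words u v := exists g, red (g ++ u ++ inv_word g) = red v.

Lemma conj_red u v : red u = red v -> conj_words u v.
Proof. by exists [::]; rewrite cats0. Qed.

Lemma conj_sym u v : conj_words u v -> conj_words v u.
Proof.
move=> [g h]; exists (inv_word g); rewrite inv_wordK.
have -> : red (inv_word g ++ v ++ g) = red (inv_word g ++ (g ++ u ++ inv_word g) ++ g).
  by apply: red_cat => //; apply: red_cat.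
rewrite -!catA red_Vmul -[in RHS](cats0 u); apply: red_cat => //.
by rewrite -{2}(cats0 g) red_Vmul.
Qed.

Lemma conj_trans v u w : conj_words u v -> conj_words v w -> conj_words u w.
Proof.
move=> [g h] [k e]; exists (k ++ g); rewrite -e inv_word_cat -!catA.
by apply: red_cat => //; rewrite !catA; apply: red_cat => //; rewrite -catA.
Qed.

Lemma conj_rot u v : conj_words (u ++ v) (v ++ u).
Proof.
exists (inv_word u); rewrite inv_wordK -!catA red_Vmul //.
Qed.

Lemma conj_cyc u v : cyc u = cyc v -> conj_words u v.
Proof.
move/cyc_eqP=> [k <-]; rewrite -{1}(cat_take_drop k u); exact: conj_rot.
Qed.

Lemma economical_reduced w : economical (cyc w) -> reduced w.
Proof.
move=> ew; have : forall u v, w = u ++ v -> reduced v.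
  move=> u v; elim: v u => // x [|y v] //= ih u hw; apply/andP; split.
    apply/negP => /eqP yx; apply: ew; exists x, (v ++ u).
    by rewrite hw cyc_cat /= yx.
  by apply: (ih (rcons u x)); rewrite cat_rcons.
by move/(_ [::]); exact.
Qed.

Lemma reduced_cat u x y v :
  reduced (rcons u x) -> reduced (y :: v) -> y != inv_letter x -> reduced (rcons u x ++ y :: v).
Proof.
rewrite /reduced; case: u => [|z u] /= hu hv ne; first by rewrite ne.
by rewrite cat_path hu last_rcons /= ne.
Qed.

(* If neither end of [w] cancels against [g], the word [g w g^-1] is already *)
(* reduced, and it is not cyclically reduced unless [g] is empty.            *)
Lemma conj_economical w w' :
  economical (cyc w) -> economical (cyc w') -> conj_words w w' -> cyc w = cyc w'.
Proof.
move=> ew ew' [g]; rewrite [red w']red_id; last exact: economical_reduced.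
have -> : red (g ++ w ++ inv_word g) = red (red g ++ w ++ inv_word (red g)).
  apply: red_cat; first by rewrite [RHS]red_id ?red_reduced.
  by apply: red_cat => //; apply: red_inv_word; rewrite [RHS]red_id ?red_reduced.
move: (red g) (red_reduced g) => {}g; elim/last_ind: g w ew => [|g x ih] w ew.
  by move=> _; rewrite /= cats0 red_id //; [move=> -> | exact: economical_reduced].
move=> hg hw'.
have inv_rcons : inv_word (rcons g x) = inv_letter x :: inv_word g.
  by rewrite /inv_word map_rcons rev_rcons.
have hg' : reduced g.
  by move: hg; rewrite -reduced_inv_word inv_rcons => /reduced_behead; rewrite reduced_inv_word.
case: w ew hw' => [|y w] ew hw'.
  by move: hw'; rewrite cat0s -[inv_word _]cats0 red_mulV => /= <-.
case: (y =P inv_letter x) => [yx|/eqP yx].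
  (* The first letter of the word cancels against the end of the conjugator. Moving it to the other
     end of the word gives a cyclic shift conjugated by the shorter [g]. *)
  have <- : cyc (w ++ [:: y]) = cyc (y :: w) by rewrite cyc_cat.
  apply: ih => //; first by rewrite cyc_cat.
  by rewrite -hw' inv_rcons cat_rcons cat_cons yx red_cancel -catA.
move: ew hw'; rewrite lastI => ew hw'.
have [zx|zx] := eqVneq (last y w) x.
  have <- : cyc (x :: belast y w) = cyc (rcons (belast y w) (last y w)).
    by rewrite zx -cats1 cyc_cat.
  apply: ih => //; first by move: ew; rewrite zx -cats1 cyc_cat.
  by rewrite -hw' inv_rcons zx (cat_rcons _ (belast y w)) [in RHS]catA red_cancel -catA cat_rcons.
(* The conjugated word is now reduced as it stands; it begins with a letter [h] and ends with its
   inverse, so a cyclic cancellation is left. *)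
case: ew'; rewrite -hw'.
have hw : reduced (rcons (belast y w) (last y w)) by apply: economical_reduced.
rewrite red_id; last first.
  rewrite -lastI; apply: reduced_cat => //; rewrite -cat_cons lastI inv_rcons; apply: reduced_cat => //.
    by rewrite -inv_rcons reduced_inv_word.
  by rewrite (inj_eq (can_inj inv_letterK)) eq_sym.
rewrite -lastI.
have [h [g0 ->]] : exists h g0, rcons g x = h :: g0 by case: (g) => [|h g0]; do 2 eexists.
exists (inv_letter h), (g0 ++ (y :: w) ++ inv_word g0); rewrite inv_letterK.
rewrite /inv_word map_cons rev_cons -cats1.
by rewrite -[inv_letter h :: h :: _]cat1s [RHS]cyc_cat /= -!catA cat_cons -catA.
Qed.

Lemma size_cyc_repr w : size (cyc_repr (cyc w)) = size w.
Proof. by have [k <-] := cyc_repr_rot w; rewrite size_rot. Qed.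

Lemma economical_form_exists (w : cyclic (letter n)) : exists v : cyclic (letter n), economical_form w v.
Proof.
move: {2}(size (cyc_repr w)).+1 (ltnSn (size (cyc_repr w))) => k.
elim: k w => // k ih w; rewrite ltnS => wk.
have [ew|] := pselect (economical w); first by exists w; split=> //; exists [::].
move=> /contrapT[x [s ws]].
have [|v [[h [ph <-]] ev]] := ih (cyc s).
  by apply: leq_trans wk; rewrite ws !size_cyc_repr.
exists (last (cyc s) h); split=> //; exists (cyc s :: h); split=> //=; rewrite ph andbT.
by apply/asboolP; exists x, s.
Qed.

Lemma word_cancel_conj (w w' : cyclic (letter n)) :
  word_cancel w w' -> conj_words (cyc_repr w) (cyc_repr w').
Proof.
move=> /asboolP[x [s [-> ->]]].
apply: (@conj_trans (x :: inv_letter x :: s)); first by apply: conj_cyc; rewrite cyc_reprK.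
apply: (@conj_trans s); last by apply: conj_cyc; rewrite cyc_reprK.
by apply: conj_red; exact: (red_cancel [::]).
Qed.

Lemma economical_form_conj (w v : cyclic (letter n)) :
  economical_form w v -> conj_words (cyc_repr w) (cyc_repr v).
Proof.
move=> [[h [ph <-]] _]; elim: h w ph => /= [w _|w' h ih w /andP[/word_cancel_conj ww' /ih]].
  exact: conj_red.
exact: conj_trans.
Qed.

(** With [w = w'] this is the uniqueness of the economical form; for conjugate words it gives the
    independence of the representative. *)
Lemma economical_form_unique (w w' v v' : cyclic (letter n)) :
  conj_words (cyc_repr w) (cyc_repr w') -> economical_form w v -> economical_form w' v' -> v = v'.
Proof.
move=> ww' wv wv'; rewrite -[v]cyc_reprK -[v']cyc_reprK.
apply: conj_economical; rewrite ?cyc_reprK; [by case: wv | by case: wv' |].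
apply: conj_trans (economical_form_conj wv'); apply: conj_trans ww'.
exact/conj_sym/economical_form_conj.
Qed.

End FreeWords.

(** * Free groups are Hopfian *)

Section Hopf.
Context {n : nat}.
Implicit Types (i : 'I_n) (x : letter n) (u v w : seq (letter n)).
Local Open Scope group_scope.

Section Eval.
Context {gT : finGroupType}.
Variable f : 'I_n -> gT.

Definition eval_letter x : gT := if x.2 then f x.1 else (f x.1)^-1.
Definition eval_word w : gT := \prod_(x <- w) eval_letter x.

Lemma eval_cat u v : eval_word (u ++ v) = eval_word u * eval_word v.
Proof. exact: big_cat. Qed.

Lemma eval_inv_letter x : eval_letter (inv_letter x) = (eval_letter x)^-1.
Proof. by case: x => i [] //; rewrite /eval_letter invgK. Qed.

Lemma eval_inv_word w : eval_word (inv_word w) = (eval_word w)^-1.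
Proof.
elim: w => [|x w ih]; first by rewrite /eval_word !big_nil invg1.
rewrite -cat1s inv_word_cat !eval_cat ih invMg; congr (_ * _).
by rewrite /eval_word !big_seq1 eval_inv_letter.
Qed.

Lemma eval_red w : eval_word (red w) = eval_word w.
Proof.
have eval_cons x v : eval_word (x :: v) = eval_letter x * eval_word v by exact: big_cons.
elim: w => //= x w ih; rewrite eval_cons -ih.
case: (red w) => //= y v; case: eqP => [->|_] //.
by rewrite !eval_cons eval_inv_letter mulKVg.
Qed.

End Eval.

(** Induction on the list: a permutation that is right on the tail is corrected at [a] by the
    transposition of [s a] and [b], which moves no value prescribed at a point other than [a]. *)
Lemma perm_extension (T : finType) (l : seq (T * T)) :
  {in l &, forall p q, (p.1 == q.1) = (p.2 == q.2)} ->
  exists s : {perm T}, {in l, forall p, s p.1 = p.2}.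
Proof.
elim: l => [_|[a b] l ih inj]; first by exists 1.
have [|s hs] := ih; first by move=> p q pl ql; apply: inj; rewrite inE ?pl ?ql orbT.
exists (s * tperm (s a) b) => p; rewrite inE permM => /predU1P[->|pl] /=; first by rewrite tpermL.
have := inj p (a, b); rewrite !inE pl eqxx orbT => /(_ isT isT) /=.
rewrite (hs _ pl); have [pa /esym/eqP pb|pa pb] := eqVneq p.1 a.
  by rewrite -pb -pa (hs _ pl) tpermL.
by rewrite tpermD // ?[b == _]eq_sym -?pb // -(hs _ pl) (inj_eq perm_inj) eq_sym.
Qed.

(* The letters of a reduced word, read as steps between consecutive elements *)
(* of [{0, ..., size w}], are partial injections; any permutations extending  *)
(* them send 0 to [size w].                                                   *)
Lemma residually_finite w : reduced w -> w != [::] ->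
  exists m (f : 'I_n -> {perm 'I_m}), eval_word f w != 1.
Proof.
case: w => // x0 w0; set w := x0 :: w0 => hw _.
pose k := size w; pose nw j := nth x0 w j.
have hred j : j.+1 < k -> nw j.+1 != inv_letter (nw j).
  by move=> hj; apply: (pathP x0 hw).
(* The word is drawn as a path through 0, ..., [k]. Its step from [j] to [j.+1] is an edge labelled
   [i], directed forwards for the letter [(i, true)] and backwards for [(i, false)]. *)
pose E i (p : 'I_k.+1 * 'I_k.+1) :=
  ((p.2 == p.1.+1 :> nat) && (nw p.1 == (i, true))) ||
  ((p.1 == p.2.+1 :> nat) && (nw p.2 == (i, false))).
have ext i : exists s : {perm 'I_k.+1}, forall p, E i p -> s p.1 = p.2.
  have [|s hs] := @perm_extension _ [seq p <- enum {: 'I_k.+1 * 'I_k.+1} | E i p].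
    move=> [[a ha] [b hb]] [[c hc] [d hd]]; rewrite !mem_filter /E /= => /andP[h1 _] /andP[h2 _].
    rewrite -!val_eqE /=.
    case/orP: h1 => /andP[/eqP e1 /eqP n1]; case/orP: h2 => /andP[/eqP e2 /eqP n2];
      subst; rewrite ?eqSS //.
    (* If a forward and a backward edge with the same label shared a source or a target, two
       consecutive letters of [w] would be mutually inverse. *)
    - apply/eqP/eqP => e; subst; [have := hred d|have := hred a];
      by rewrite n1 n2 eqxx => /(_ ltac:(done)).
    - apply/eqP/eqP => e; subst; [have := hred b|have := hred c];
      by rewrite n1 n2 eqxx => /(_ ltac:(done)).
  by exists s => p hp; apply: hs; rewrite mem_filter hp mem_enum.
have [f hf] := choice ext.
exists k.+1, f; apply/eqP => ew1.
have step j : j <= k -> eval_word f (take j w) ord0 = inord j.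
  elim: j => [_|j ih jk]; first by rewrite take0 /eval_word big_nil perm1; apply/val_inj; rewrite /= inordK.
  rewrite (take_nth x0) // -cats1 eval_cat permM ih; last exact: ltnW.
  rewrite /eval_word big_seq1 /eval_letter -/(nw j).
  case e: (nw j) => [i []] /=.
    by apply: (hf i (inord j, inord j.+1)); rewrite /E /= !inordK ?e ?eqxx // ltnS ltnW.
  apply: (canLR (permK _)); apply/esym.
  by apply: (hf i (inord j.+1, inord j)); rewrite /E /= !inordK ?e ?eqxx ?orbT // ltnS ltnW.
have := step k (leqnn k); rewrite take_size ew1 perm1 => /(congr1 val).
by rewrite /= inordK.
Qed.

Definition subst_word (phi : 'I_n -> seq (letter n)) w :=
  flatten [seq if x.2 then phi x.1 else inv_word (phi x.1) | x <- w].

Lemma subst_cat phi u v : subst_word phi (u ++ v) = subst_word phi u ++ subst_word phi v.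
Proof. by rewrite /subst_word map_cat flatten_cat. Qed.

Lemma subst_inv_word phi w : subst_word phi (inv_word w) = inv_word (subst_word phi w).
Proof.
elim: w => // x w ih; rewrite -cat1s inv_word_cat !subst_cat ih inv_word_cat; congr (_ ++ _).
rewrite -[inv_word [:: x]]/[:: inv_letter x].
by case: x => i []; rewrite /subst_word /= !cats0 ?inv_wordK.
Qed.

Lemma eval_subst (gT : finGroupType) (f : 'I_n -> gT) phi w :
  eval_word f (subst_word phi w) = eval_word (fun i => eval_word f (phi i)) w.
Proof.
elim: w => [|x w ih]; first by rewrite /eval_word /= !big_nil.
rewrite -cat1s subst_cat eval_cat ih [RHS]eval_cat; congr (_ * _).
rewrite /subst_word /= cats0 [RHS]/eval_word big_seq1 /eval_letter.
by case: x.2; rewrite ?eval_inv_word.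
Qed.

(* Precomposition with a surjective endomorphism is injective on the finite  *)
(* set of homomorphisms to a finite group, hence bijective: every such       *)
(* homomorphism factors through it and kills its kernel. Conclude by         *)
(* residual finiteness.                                                      *)
Lemma free_group_hopfian (phi : 'I_n -> seq (letter n)) :
  (forall i, exists v, red (subst_word phi v) = [:: (i, true)]) ->
  forall w, red (subst_word phi w) = [::] -> red w = [::].
Proof.
move=> surj w hw; apply/eqP; apply: contrapT => /negP wn.
have [m [f]] := residually_finite (red_reduced w) wn; rewrite eval_red; apply/negP; rewrite negbK.
(* A homomorphism to the symmetric group is recorded by the images of the generators, so there are
   finitely many; [T] is precomposition with the endomorphism. *)
pose T (h : {ffun 'I_n -> {perm 'I_m}}) := [ffun i => eval_word h (phi i)].
have evalT h v : eval_word (T h) v = eval_word h (subst_word phi v).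
  by rewrite eval_subst; apply: eq_bigr => x _; rewrite /eval_letter !ffunE.
have T_inj : injective T.
  move=> h h' e; apply/ffunP => i; have [v hv] := surj i.
  have val (k : {ffun 'I_n -> {perm 'I_m}}) : k i = eval_word (T k) v.
    by rewrite evalT -eval_red hv /eval_word big_seq1.
  by rewrite !val e.
have [T' _ TT'] := injF_bij T_inj.
have -> : eval_word f w = eval_word (T (T' (finfun f))) w.
  by rewrite TT'; apply: eq_bigr => x _; rewrite /eval_letter !ffunE.
by rewrite evalT -eval_red hw /eval_word big_nil.
Qed.

Lemma subst_surj (phi : 'I_n -> seq (letter n)) :
  (forall i, exists v, red (subst_word phi v) = [:: (i, true)]) ->
  forall w, exists v, red (subst_word phi v) = red w.
Proof.
move=> surj; elim=> [|x w [v hv]]; first by exists [::].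
have [t ht] : exists t, red (subst_word phi t) = red [:: x].
  case: x => i b; have [t ht] := surj i; case: b; first by exists t.
  by exists (inv_word t); rewrite subst_inv_word (red_inv_word (v := [:: (i, true)])).
by exists (t ++ v); rewrite subst_cat -[x :: w]cat1s; apply: red_cat.
Qed.

(** The conjugating word [g] is pulled back to some [t] by surjectivity; then [t u t^-1 v^-1] lies
    in the kernel, which is trivial. *)
Lemma subst_conj_inj (phi : 'I_n -> seq (letter n)) :
  (forall i, exists v, red (subst_word phi v) = [:: (i, true)]) ->
  forall u v, conj_words (subst_word phi u) (subst_word phi v) -> conj_words u v.
Proof.
move=> surj u v [g hg]; have [t ht] := subst_surj surj g; exists t.
have e : red (subst_word phi (t ++ u ++ inv_word t ++ inv_word v)) = [::].
  rewrite !subst_cat !catA -[RHS](red_mulV (subst_word phi v) [::]) cats0.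
  rewrite subst_inv_word; apply: red_cat; last by rewrite subst_inv_word.
  rewrite -hg -catA; apply: red_cat => //; apply: red_cat => //; exact: red_inv_word.
have h : red (t ++ u ++ inv_word t ++ inv_word v) = red [::] by exact: free_group_hopfian e.
have {h} := red_cat h (erefl (red v)); rewrite -!catA /= => <-.
do 2![apply: red_cat => //]; rewrite -[in LHS](cats0 (inv_word t)); apply: red_cat => //.
by rewrite -(red_Vmul v [::]) cats0.
Qed.

End Hopf.

Local Open Scope classical_set_scope.
Local Open Scope ring_scope.

(** * Poincare words of segments *)

Section SortByKey.
Context {R : realType} {T : eqType}.
Implicit Types (t : T -> R) (s : seq T).

Local Notation le_key t := (fun i j => t i <= t j).

Let le_key_trans t : transitive (le_key t).
Proof. by move=> i j k; exact: le_trans. Qed.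

Let sort_key_sorted t s : sorted (le_key t) (sort (le_key t) s).
Proof. by apply: sort_sorted => i j; exact: le_total. Qed.

Lemma sort_key_unique t s s' : {in s &, injective t} -> perm_eq s' s ->
  sorted (le_key t) s' -> s' = sort (le_key t) s.
Proof.
move=> tinj ss' hs'; apply: (@sorted_eq_in _ (le_key t)) => //.
- by move=> i j k _ _ _; exact: le_key_trans.
- by move=> i j; rewrite !(perm_mem ss') => si sj /le_anti; exact: tinj.
- by rewrite perm_sym perm_sort perm_sym.
Qed.

Lemma sort_key_split t (a : pred T) s :
  {in s &, injective t} -> {in s &, forall i j, a i -> ~~ a j -> t i <= t j} ->
  sort (le_key t) s = sort (le_key t) [seq i <- s | a i] ++ sort (le_key t) [seq i <- s | ~~ a i].
Proof.
move=> tinj ta; symmetry; apply: sort_key_unique => //.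
  apply: (@perm_trans _ ([seq i <- s | a i] ++ [seq i <- s | predC a i])).
    by apply: perm_cat; rewrite perm_sort.
  by rewrite perm_filterC.
have tr := @le_key_trans t.
rewrite (sorted_pairwise tr) pairwise_cat -!(sorted_pairwise tr) !sort_key_sorted !andbT.
apply/allrelP => i j; rewrite !mem_sort !mem_filter => /andP[ai si] /andP[aj sj].
exact: ta.
Qed.

Lemma sort_key_rev t t' s :
  {in s &, injective t} -> {in s &, forall i j, (t' i <= t' j) = (t j <= t i)} ->
  sort (le_key t') s = rev (sort (le_key t) s).
Proof.
move=> tinj tt'; symmetry; apply: sort_key_unique.
- move=> i j si sj e; apply: tinj => //; apply: le_anti.
  by rewrite -!tt' // e lexx.
- by rewrite perm_rev perm_sort.
rewrite rev_sorted; apply: (sub_in_sorted (P := mem s) (e := le_key t)) => //.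
  by move=> i j si sj; rewrite tt'.
by apply/allP => i; rewrite mem_sort.
Qed.

Lemma sort_key_eq t t' s :
  {in s &, injective t} -> {in s &, forall i j, (t' i <= t' j) = (t i <= t j)} ->
  sort (le_key t') s = sort (le_key t) s.
Proof.
move=> tinj tt'; apply: sort_key_unique => //; first by rewrite perm_sort.
apply: (sub_in_sorted (P := mem s) (e := le_key t')) => //.
  by move=> i j si sj; rewrite tt'.
by apply/allP => i; rewrite mem_sort.
Qed.

End SortByKey.

(** * Segments, triangles and convexity *)

Section Geometry.
Context {R : realType}.
Local Notation point := 'rV[R]_2.
Implicit Types (A B C X Y Z u : point) (K : set point).

Lemma point_eq X Y : X 0 0 = Y 0 0 -> X 0 1 = Y 0 1 -> X = Y.
Proof.
move=> e0 e1; apply/rowP => j; case: j => -[|[|//]] h.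
  by rewrite (_ : Ordinal h = 0) //; apply/val_inj.
by rewrite (_ : Ordinal h = 1) //; apply/val_inj.
Qed.

Definition lerp A B (t : R) : point := A + t *: (B - A).

Definition convex K := forall A B t, K A -> K B -> 0 <= t <= 1 -> K (lerp A B t).

Lemma convex_hull A B C : convex (triangle_hull A B C).
Proof.
move=> X Y t [a [b [c [a0 b0 c0 e ->]]]] [a' [b' [c' [a'0 b'0 c'0 e' ->]]]] /andP[t0 t1].
exists ((1 - t) * a + t * a'), ((1 - t) * b + t * b'), ((1 - t) * c + t * c').
split; try by apply: addr_ge0; apply: mulr_ge0 => //; rewrite subr_ge0.
- transitivity ((1 - t) * (a + b + c) + t * (a' + b' + c')); first by ring.
  by rewrite e e'; ring.
- by apply: point_eq; rewrite /lerp !mxE; ring.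
Qed.

Lemma hull1 A B C : triangle_hull A B C A.
Proof. by exists 1, 0, 0; split; rewrite ?addr0 //; rewrite scale1r !scale0r !addr0. Qed.
Lemma hull2 A B C : triangle_hull A B C B.
Proof. by exists 0, 1, 0; split; rewrite ?add0r ?addr0 //; rewrite scale1r !scale0r add0r addr0. Qed.
Lemma hull3 A B C : triangle_hull A B C C.
Proof. by exists 0, 0, 1; split; rewrite ?add0r //; rewrite scale1r !scale0r !add0r. Qed.

Lemma hull_segment A B C K X Y : triangle_hull A B C `<=` K ->
  triangle_hull A B C X -> triangle_hull A B C Y -> segment X Y `<=` K.
Proof. by move=> hK hX hY Z [t [ht ->]]; apply: hK; exact: convex_hull. Qed.

Lemma hull_sub A B C K : convex K -> K A -> K B -> K C -> triangle_hull A B C `<=` K.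
Proof.
move=> cK kA kB kC X [a [b [c [a0 b0 c0 e ->]]]].
have [b1|bc] := eqVneq (b + c) 0.
  have -> : b = 0 by lra.
  have -> : c = 0 by lra.
  have -> : a = 1 by lra.
  by rewrite scale1r !scale0r !addr0.
have bc0 : 0 < b + c by rewrite lt_neqAle eq_sym bc addr_ge0.
have -> : a *: A + b *: B + c *: C = lerp A (lerp B C (c / (b + c))) (b + c).
  have -> : a = 1 - (b + c) by lra.
  by apply: point_eq; rewrite /lerp !mxE; field.
apply: (cK) => //; last by lra.
apply: cK => //; rewrite divr_ge0 ?addr_ge0 //= ler_pdivrMr // mul1r; lra.
Qed.

Lemma convex_segment A B : convex (segment A B).
Proof.
move=> X Y t [x [hx ->]] [y [hy ->]] /andP[t0 t1]; exists ((1 - t) * x + t * y); split; first nra.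
by apply: point_eq; rewrite /lerp !mxE; ring.
Qed.

Lemma hull_ABA A B : triangle_hull A B A = segment A B.
Proof.
apply/seteqP; split.
  apply: hull_sub; first exact: convex_segment.
  - by exists 0; rewrite lexx ler01 scale0r addr0.
  - by exists 1; rewrite lexx ler01 scale1r addrC subrK.
  - by exists 0; rewrite lexx ler01 scale0r addr0.
by move=> X [t [ht ->]]; apply: convex_hull => //; [exact: hull1 | exact: hull2].
Qed.

End Geometry.

(** * Rays as disjoint chords of a convex set *)

Section Rays.
Context {R : realType} {n : nat}.
Local Notation point := 'rV[R]_2.
Variables (P v : 'I_n -> point).
Implicit Types (A B C X Y Z : point) (K : set point) (i j : 'I_n).

Definition ray i : set point := [set X | exists t : R, 0 <= t /\ X = P i + t *: v i].

Hypothesis v_neq0 : forall i, v i != 0.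
Hypothesis ray_disjoint : forall i j X, i != j -> ray i X -> ~ ray j X.

Definition dev i X : R := cross (v i) (X - P i).

Definition side i X := dev i X < 0.

(** The zero of the affine function [dev i] on the line [AB], as a parameter. If [dev i] agrees at
    [A] and [B] the division by zero gives 0, but [cuts] only consults it when the sides differ. *)
Definition cut_time A B i : R := dev i A / (dev i A - dev i B).

Definition cuts A B i := (side i A != side i B) && `[< ray i (lerp A B (cut_time A B i)) >].

(* The Poincare word of the segment [AB], with the convention that the points *)
(* of the line through the ray [i] lie on the side [0 <= dev i]. It makes     *)
(* sense without any general position assumption.                             *)
Definition cut_word A B : seq (letter n) :=
  [seq (i, side i B) | i <- sort (fun i j => cut_time A B i <= cut_time A B j)
                              [seq i <- enum 'I_n | cuts A B i]].

Lemma dev_lerp i A B t : dev i (lerp A B t) = (1 - t) * dev i A + t * dev i B.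
Proof. by rewrite /dev /cross /lerp !mxE; ring. Qed.

Lemma dev_ray i X : ray i X -> dev i X = 0.
Proof. by move=> [t [_ ->]]; rewrite /dev /cross !mxE; ring. Qed.

Lemma ray_origin i : ray i (P i).
Proof. by exists 0; rewrite lexx scale0r addr0. Qed.

Lemma cut_timeP i A B : side i A != side i B ->
  0 <= cut_time A B i <= 1 /\ dev i (lerp A B (cut_time A B i)) = 0.
Proof.
rewrite dev_lerp /cut_time /side; set a := dev i A; set b := dev i B => hs.
have ab : a - b != 0.
  apply/eqP => ab; move: hs; have -> : a = b by lra.
  by rewrite eqxx.
have e : a / (a - b) * (a - b) = a by rewrite divfK.
split; last by move: e; set t := a / _; lra.
by move: e hs; set t := a / _; case: (ltP a 0) => ha; case: (ltP b 0) => hb // e _; nra.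
Qed.

Lemma side_lerp i A B t : 0 <= t <= 1 -> side i A = side i B -> side i (lerp A B t) = side i A.
Proof.
rewrite /side dev_lerp; set a := dev i A; set b := dev i B => ht.
by case: (ltP a 0) => ha; case: (ltP b 0) => hb // _; apply/idP; nra.
Qed.

Section Convex.
Variable K : set point.
Hypothesis K_convex : convex K.
Hypothesis K_avoids : forall i, ~ K (P i).

Definition active i := `[< exists X, K X /\ ray i X >].

(** The convex set [K] meets the line carrying the ray in a convex set that misses the origin [P i].
    Once it contains a point of the ray, it contains none of the opposite half-line. *)
Lemma dev0_ray i Y : active i -> K Y -> dev i Y = 0 -> ray i Y.
Proof.
move=> /asboolP[X [kX [s [s0 eX]]]] kY.
rewrite /dev /cross => hY.
have : exists t, Y = P i + t *: v i.
  have : (v i 0 0 != 0) || (v i 0 1 != 0).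
    by apply/contraT; rewrite negb_or !negbK => /andP[/eqP a /eqP b];
      case/negP: (v_neq0 i); apply/eqP/point_eq; rewrite !mxE.
  rewrite !mxE in hY; case/orP => h.
    exists ((Y 0 0 - P i 0 0) / v i 0 0); apply: point_eq; rewrite !mxE; first by field.
    by apply: (mulfI h); rewrite mulrDr mulrA mulrCA mulfV // mulr1; lra.
  exists ((Y 0 1 - P i 0 1) / v i 0 1); apply: point_eq; rewrite !mxE; last by field.
  by apply: (mulfI h); rewrite mulrDr mulrA mulrCA mulfV // mulr1; lra.
move=> [t eY]; exists t; split=> //; rewrite leNgt; apply/negP => t0.
(* The parameters [s] of [X] and [t] of [Y] on the line have opposite signs, so the origin lies
   between the two points; the weight is where the parameter becomes 0. *)
case: (K_avoids (i := i)); have -> : P i = lerp X Y (s / (s - t)).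
  have : s - t != 0 by rewrite subr_eq0 gt_eqF // (lt_le_trans t0).
  by rewrite eX eY => h; apply: point_eq; rewrite /lerp !mxE; field.
apply: K_convex => //; have h : 0 < s - t by lra.
  by apply/andP; split; [apply: divr_ge0 | rewrite ler_pdivrMr // mul1r]; lra.
Qed.

Lemma cutsE A B i : K A -> K B -> cuts A B i = active i && (side i A != side i B).
Proof.
move=> kA kB; rewrite /cuts andbC; have [hs|] := boolP (side i A != side i B); last by rewrite !andbF.
rewrite !andbT; have [ht h0] := cut_timeP hs.
apply/asboolP/idP => [h|/dev0_ray]; last by apply=> //; exact: K_convex.
by apply/asboolP; eexists; split; [|exact: h]; exact: K_convex.
Qed.

Lemma active_disjoint i j X : active i -> active j -> i != j -> K X -> dev i X = 0 -> dev j X != 0.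
Proof.
move=> ai aj ij kX hi; apply/eqP => hj.
by apply: (ray_disjoint ij); [exact: (dev0_ray ai kX hi) | exact: dev0_ray].
Qed.

(** Otherwise [dev j] would vanish between [X] and [Y], at a point of [K] common to two active rays.
    This is what makes the order of crossings comparable on different segments. *)
Lemma active_side i j X Y : active i -> active j -> i != j -> K X -> K Y ->
  dev i X = 0 -> dev i Y = 0 -> side j X = side j Y.
Proof.
move=> ai aj ij kX kY iX iY; apply/eqP; apply/contraT => hs.
have [ht h0] := cut_timeP hs.
have := @active_disjoint i j _ ai aj ij (K_convex kX kY ht).
by rewrite h0 dev_lerp iX iY !mulr0 addr0 eqxx => /(_ erefl).
Qed.

(** Turns the order of two crossings into a statement about sides, which [active_side] can transport
    to another segment. *)
Lemma cut_time_le i j A B : K A -> K B -> i != j -> cuts A B i -> cuts A B j ->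
  (cut_time A B i <= cut_time A B j) = (side j (lerp A B (cut_time A B i)) == side j A).
Proof.
move=> kA kB ij; rewrite !cutsE // => /andP[ai si] /andP[aj sj].
have [ti h0] := cut_timeP si; have [tj h1] := cut_timeP sj.
have := @active_disjoint i j _ ai aj ij (K_convex kA kB ti) h0.
move: sj h1; rewrite /side !dev_lerp.
move: (cut_time A B i) (cut_time A B j) ti tj => t t' ht ht'.
move: (dev j A) (dev j B) => a b.
have [ha|ha] := ltP a 0; have [hb|hb] := ltP b 0 => // _ h1 /eqP h2.
  by rewrite eqb_id; apply/idP/idP => h; [rewrite lt_neqAle; apply/andP; split; [exact/eqP|nra] | nra].
rewrite eqbF_neg -leNgt; apply/idP/idP => h; nra.
Qed.

Lemma cut_time_inj A B : K A -> K B ->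
  {in [seq i <- enum 'I_n | cuts A B i] &, injective (cut_time A B)}.
Proof.
move=> kA kB i j; rewrite !mem_filter !cutsE // => /andP[/andP[ai si] _] /andP[/andP[aj sj] _] e.
apply/eqP/contraT => ij.
have [ti h0] := cut_timeP si; have [tj h1] := cut_timeP sj.
by have := @active_disjoint i j _ ai aj ij (K_convex kA kB ti) h0; rewrite e h1 eqxx.
Qed.

(** Ray [j] leaves [A] and [C] on one side, hence also the point where [AC] meets ray [i]. By
    [active_side] the crossing of [AB] with ray [i] is on that side too, so it comes before the
    crossing with [j]. *)
Lemma cut_before A B C i j : K A -> K B -> K C -> cuts A B i -> cuts A B j ->
  cuts A C i -> ~~ cuts A C j -> cut_time A B i <= cut_time A B j.
Proof.
move=> kA kB kC bi bj ci cj; have [->//|ij] := eqVneq i j.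
rewrite cut_time_le //.
move: bi bj ci cj; rewrite !cutsE // => /andP[ai si] /andP[aj sj] /andP[_ si'].
rewrite aj /= negbK => /eqP sj'.
have [ti h0] := cut_timeP si; have [t'i h'0] := cut_timeP si'.
rewrite (@active_side i j _ (lerp A C (cut_time A C i))) ?side_lerp //; exact: K_convex.
Qed.

Lemma cut_time_leE i j A B C D : K A -> K B -> K C -> K D -> i != j ->
  cuts A B i -> cuts A B j -> cuts C D i ->
  (cut_time A B i <= cut_time A B j) = (side j (lerp C D (cut_time C D i)) == side j A).
Proof.
move=> kA kB kC kD ij bi bj di; rewrite cut_time_le //.
move: bi bj di; rewrite !cutsE // => /andP[ai si] /andP[aj sj] /andP[_ di].
have [ti h0] := cut_timeP si; have [t'i h'0] := cut_timeP di.
by congr (_ == _); apply: (@active_side i j) => //; exact: K_convex.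
Qed.

(* The words [p], [q], [r] collect the rays that separate [A], [B], [C]     *)
(* respectively from the two other vertices.                                *)
Lemma cut_word_triangle A B C : K A -> K B -> K C -> exists p q r,
  [/\ cut_word A B = p ++ q, cut_word B C = inv_word q ++ r & cut_word A C = p ++ r].
Proof.
move=> kA kB kC; pose cAB := cuts A B; pose cBC := cuts B C; pose cAC := cuts A C.
pose F a := [seq i <- enum 'I_n | a i].
have inF a i : i \in F a -> a i by rewrite mem_filter => /andP[].
have FI a b : [seq i <- F a | b i] = F (fun i => b i && a i) by rewrite /F -filter_predI.
have swap i : cuts B A i = cAB i by rewrite /cAB !cutsE // [side i B == _]eq_sym.
(* An active ray separates none or exactly two of the three pairs of vertices. Hence cutting [AB]
   but not [AC] is the same as cutting [AB] and [BC]. *)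
have q_eq : F (fun i => ~~ cAC i && cAB i) = F (fun i => cAB i && cBC i).
  apply: eq_filter => i; rewrite /cAC /cAB /cBC !cutsE //.
  by case: (active i) (side i A) (side i B) (side i C) => [] [] [] [].
have r_eq : F (fun i => ~~ cAB i && cAC i) = F (fun i => ~~ cAB i && cBC i).
  apply: eq_filter => i; rewrite /cAC /cAB /cBC !cutsE //.
  by case: (active i) (side i A) (side i B) (side i C) => [] [] [] [].
have p_eq : F (fun i => cAC i && cAB i) = F (fun i => cAB i && cAC i).
  by apply: eq_filter => i; rewrite andbC.
have sub_inj X Y (a : pred 'I_n) : K X -> K Y -> (forall i, a i -> cuts X Y i) ->
    {in F a &, injective (cut_time X Y)}.
  move=> kX kY ab i j /inF ai /inF aj; apply: (cut_time_inj kX kY);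
  by rewrite mem_filter mem_enum andbT; apply: ab.
have hAB : cut_word A B =
    [seq (i, side i B) | i <- sort (fun i j => cut_time A B i <= cut_time A B j) (F (fun i => cAC i && cAB i))] ++
    [seq (i, side i B) | i <- sort (fun i j => cut_time A B i <= cut_time A B j) (F (fun i => ~~ cAC i && cAB i))].
  rewrite /cut_word -map_cat -(FI cAB cAC) -(FI cAB (fun i => ~~ cAC i)); congr map;
    apply: sort_key_split; first exact: cut_time_inj.
  by move=> i j /inF bi /inF bj ci cj; exact: (@cut_before A B C).
have hAC : cut_word A C =
    [seq (i, side i C) | i <- sort (fun i j => cut_time A C i <= cut_time A C j) (F (fun i => cAB i && cAC i))] ++
    [seq (i, side i C) | i <- sort (fun i j => cut_time A C i <= cut_time A C j) (F (fun i => ~~ cAB i && cAC i))].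
  rewrite /cut_word -map_cat -(FI cAC cAB) -(FI cAC (fun i => ~~ cAB i)); congr map;
    apply: sort_key_split; first exact: cut_time_inj.
  by move=> i j /inF bi /inF bj ci cj; exact: (@cut_before A C B).
have hBC : cut_word B C =
    [seq (i, side i C) | i <- sort (fun i j => cut_time B C i <= cut_time B C j) (F (fun i => cAB i && cBC i))] ++
    [seq (i, side i C) | i <- sort (fun i j => cut_time B C i <= cut_time B C j) (F (fun i => ~~ cAB i && cBC i))].
  rewrite /cut_word -map_cat -(FI cBC cAB) -(FI cBC (fun i => ~~ cAB i)); congr map;
    apply: sort_key_split; first exact: cut_time_inj.
  by move=> i j /inF bi /inF bj ci cj; apply: (@cut_before B C A); rewrite ?swap.
eexists _, _, _; split; [exact: hAB | rewrite hBC; congr (_ ++ _) | rewrite hAC; congr (_ ++ _)].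
(* Along [BC] the rays of [q] are met in the reverse order, and each is crossed towards the side
   opposite to the one reached along [AB]; this gives the inverse word. *)
-  rewrite q_eq (@sort_key_rev _ _ (cut_time A B)).
  + rewrite /inv_word map_rev -map_comp; congr rev; apply/eq_in_map => i.
    rewrite mem_sort => /inF /andP[]; rewrite /cAB /cBC !cutsE // => /andP[_ si] /andP[_ sj].
    by rewrite /= /inv_letter /=; congr (_, _); move: si sj; do 3!case: side.
  + by apply: (sub_inj A B) => // i /andP[].
  + move=> i j /inF/andP[bi ci] /inF/andP[bj cj].
    have [->|ij] := eqVneq i j; first by rewrite !lexx.
    rewrite (@cut_time_leE i j B C A B) // leNgt lt_neqAle (@cut_time_leE i j A B A B) //.
    have -> : cut_time A B i != cut_time A B j.
      apply: contra ij => /eqP e; apply/eqP; apply: (sub_inj A B cAB) e => //;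
      by rewrite mem_filter mem_enum andbT.
    by move: bj; rewrite /cAB cutsE // => /andP[_]; do 3!case: side.
- rewrite p_eq (@sort_key_eq _ _ (cut_time A B)).
  + apply/eq_in_map => i; rewrite mem_sort => /inF /andP[].
    rewrite /cAB /cAC !cutsE // => /andP[_ si] /andP[_ sj].
    by congr (_, _); move: si sj; do 3!case: side.
  + by apply: (sub_inj A B) => // i /andP[].
  + move=> i j /inF/andP[bi ci] /inF/andP[bj cj].
    have [->|ij] := eqVneq i j; first by rewrite !lexx.
    by rewrite (@cut_time_leE i j A C A B) // (@cut_time_leE i j A B A B).
- rewrite -r_eq.
  rewrite [in RHS](@sort_key_eq _ _ (cut_time A C)) //.
  + by apply: (sub_inj A C) => // i /andP[].
  + move=> i j; rewrite {1 2}r_eq => hi hj.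
    have [->|ij] := eqVneq i j; first by rewrite !lexx.
    move: (hi) (hj); rewrite -{1 2}r_eq.
    move/inF: hi => /andP[bi ci]; move/inF: hj => /andP[bj cj] /inF/andP[_ di] /inF/andP[_ dj].
    rewrite (@cut_time_leE i j B C A C) // (@cut_time_leE i j A C A C) //.
    move: bj cj; rewrite /cAB /cBC !cutsE // => bj /andP[aj _].
    by move: bj; rewrite aj; do 3!case: side.
Qed.

End Convex.
End Rays.

(** * Homotopies of paths and closed polygonal lines *)

Section PathHomotopy.
Context {R : realType}.
Local Notation point := 'rV[R]_2.
Variable N : set point.
Implicit Types (A B C : point) (s t p q : seq point).

(** Homotopy with fixed endpoints: only inner vertices come and go. Nothing is asked of the segments
    outside the triangle, so that a homotopy can be carried out inside any longer path; membership
    in [N] is tracked separately. *)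
Inductive path_homotopic : seq point -> seq point -> Prop :=
| PathCancel p A B C q : triangle_hull A B C `<=` N ->
    path_homotopic (p ++ A :: B :: C :: q) (p ++ A :: C :: q)
| PathRefl s : path_homotopic s s
| PathSym s t : path_homotopic s t -> path_homotopic t s
| PathTrans t s u : path_homotopic s t -> path_homotopic t u -> path_homotopic s u.

Lemma path_homotopic_cat p q s t :
  path_homotopic s t -> path_homotopic (p ++ s ++ q) (p ++ t ++ q).
Proof.
elim=> [p' A B C q' h|*|? ? _|s' t' u _ + _]; [|exact: PathRefl|exact: PathSym|exact: PathTrans].
by rewrite -!catA !cat_cons !catA; exact: PathCancel.
Qed.

Lemma path_homotopic_catl p s t : path_homotopic s t -> path_homotopic (p ++ s) (p ++ t).
Proof. by move/(path_homotopic_cat p [::]); rewrite !cats0. Qed.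

Lemma path_homotopic_catr q s t : path_homotopic s t -> path_homotopic (s ++ q) (t ++ q).
Proof. exact: path_homotopic_cat [::] q _ _. Qed.

Lemma triangle_hull_rev A B C : triangle_hull A B C `<=` triangle_hull C B A.
Proof.
by apply: hull_sub; [exact: convex_hull | exact: hull3 | exact: hull2 | exact: hull1].
Qed.

Lemma path_homotopic_rev s t : path_homotopic s t -> path_homotopic (rev s) (rev t).
Proof.
elim=> [p A B C q h|*|? ? _|s' t' u _ + _]; [|exact: PathRefl|exact: PathSym|exact: PathTrans].
rewrite !rev_cat !rev_cons -!cats1 -!catA /=; apply: PathCancel.
exact: subset_trans (@triangle_hull_rev _ _ _) h.
Qed.

(** Homotopy of closed lines read on vertex sequences, which avoids handling the dependent type
    [polyline N]. It entails that both sequences lie in [N]. *)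
Definition homotopic_seq s t := exists l l' : polyline N,
  [/\ \val l = cyc s, \val l' = cyc t & homotopic l l'].

Lemma polyline_of s : polyline_in N s -> exists l : polyline N, \val l = cyc s.
Proof. by move=> /polyline_in_cyc/asboolP h; exists (exist _ (cyc s) h). Qed.

Lemma polyline_vertices (l : polyline N) : polyline_in N (vertices l).
Proof. exact/asboolP/(valP l). Qed.

Lemma polyline_cyc s t : cyc s = cyc t -> polyline_in N s -> polyline_in N t.
Proof. by move=> st /polyline_in_cyc; rewrite st => /polyline_in_cyc. Qed.

Lemma homotopic_seq_cyc s t : polyline_in N s -> cyc s = cyc t -> homotopic_seq s t.
Proof.
move=> /polyline_of[l hl] st; exists l, l; split => //; first by rewrite -st.
exact: homotopic_refl.
Qed.

Lemma homotopic_seq_sym s t : homotopic_seq s t -> homotopic_seq t s.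
Proof. by move=> [l [l' [hl hl' h]]]; exists l', l; split; rewrite // homotopic_sym. Qed.

Lemma homotopic_seq_trans t s u : homotopic_seq s t -> homotopic_seq t u -> homotopic_seq s u.
Proof.
move=> [l [l' [hl hl' h]]] [k [k' [hk hk' e]]]; exists l, k'; split => //.
by apply: homotopic_trans h _; have -> : l' = k by apply: val_inj; rewrite hk hl'.
Qed.

Lemma homotopic_seq_polyline s t : homotopic_seq s t -> polyline_in N s /\ polyline_in N t.
Proof.
move=> [l [l' [hl hl' _]]]; split.
  by apply: polyline_cyc (polyline_vertices l); rewrite -hl cyc_reprK.
by apply: polyline_cyc (polyline_vertices l'); rewrite -hl' cyc_reprK.
Qed.

Lemma homotopic_ind (Q : seq point -> seq point -> Prop) :
  (forall s t, cyc s = cyc t -> Q s t) -> (forall s t, Q s t -> Q t s) ->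
  (forall s t u, Q s t -> Q t u -> Q s u) ->
  (forall B C s, polyline_in N (B :: C :: s) -> triangle_hull (last C s) B C `<=` N ->
     Q (B :: C :: s) (C :: s)) ->
  forall l l' : polyline N, homotopic l l' -> Q (vertices l) (vertices l').
Proof.
move=> Qcyc Qsym Qtrans Qstep l l' /asboolP[h [ph <-]].
have cancel (k k' : polyline N) : line_cancel k k' -> Q (vertices k) (vertices k').
  move=> /asboolP[B [C [s [hk hk' hN]]]].
  have kB : cyc (vertices k) = cyc (B :: C :: s) by rewrite -hk cyc_reprK.
  apply: (Qtrans _ _ _ (Qcyc _ _ kB)).
  have hB := polyline_cyc kB (polyline_vertices k).
  apply: (Qtrans _ _ _ (Qstep _ _ _ hB hN)).
  by apply: (Qcyc); rewrite -hk' cyc_reprK.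
elim: h l ph => /= [l _|k h ih l /andP[/orP[lk|kl] /ih]].
- exact: Qcyc.
- exact: (Qtrans _ _ _ (cancel _ _ lk)).
- exact: (Qtrans _ _ _ (Qsym _ _ (cancel _ _ kl))).
Qed.

Lemma cyclic_pairs_cons A s : cyclic_pairs (A :: s) = zip (A :: s) (rcons s A).
Proof. by rewrite /cyclic_pairs rot1_cons. Qed.

Fixpoint path_in A s : Prop :=
  if s is B :: s' then segment A B `<=` N /\ path_in B s' else True.

Lemma path_in_cat A s t : path_in A (s ++ t) <-> path_in A s /\ path_in (last A s) t.
Proof. by elim: s A => [A|B s ih A] /=; [tauto | rewrite ih; tauto]. Qed.

Lemma polyline_inE A s : polyline_in N (A :: s) <-> path_in A (rcons s A).
Proof.
rewrite /polyline_in cyclic_pairs_cons.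
have gen B : (forall e, e \in zip (A :: s) (rcons s B) -> segment e.1 e.2 `<=` N)
    <-> path_in A (rcons s B).
  elim: s A => [|C s ih] A /=.
    split; first by move=> h; split=> //; apply: (h (A, B)); rewrite mem_head.
    by move=> [h _] e; rewrite inE => /eqP->.
  rewrite -ih; split=> [h|[h h'] e].
    split; first by apply: (h (A, C)); rewrite mem_head.
    by move=> e he; apply: h; rewrite inE he orbT.
  by rewrite inE => /orP[/eqP->|/h'].
by rewrite gen; split=> [[]|].
Qed.

Lemma homotopic_seq_cancel B C s : polyline_in N (B :: C :: s) ->
  triangle_hull (last C s) B C `<=` N -> homotopic_seq (B :: C :: s) (C :: s).
Proof.
move=> hB hN; have [l hl] := polyline_of hB.
have hC : polyline_in N (C :: s).
  move/polyline_inE: hB; rewrite /= -!cats1 !path_in_cat /= => -[_ [hs _]].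
  apply/polyline_inE; rewrite -cats1 path_in_cat; split => //=; split => //.
  by apply: (hull_segment hN); [exact: hull1 | exact: hull3].
have [l' hl'] := polyline_of hC; exists l, l'; split => //.
apply/asboolP; exists [:: l']; split => //=; rewrite andbT; apply/orP; left.
by apply/asboolP; exists B, C, s.
Qed.

Lemma polyline_path_cancel p A B C q : triangle_hull A B C `<=` N ->
  polyline_in N (p ++ A :: B :: C :: q) <-> polyline_in N (p ++ A :: C :: q).
Proof.
move=> hN.
have rw s : polyline_in N (p ++ A :: s) <-> polyline_in N (A :: s ++ p).
  by split; apply: polyline_cyc; rewrite cyc_cat.
rewrite !rw /= !polyline_inE /=; split=> [[_ [_ h]]|[_ h]]; repeat split => //;
  apply: (hull_segment hN); by [exact: hull1 | exact: hull2 | exact: hull3].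
Qed.

Lemma homotopic_seq_path s t : path_homotopic s t -> polyline_in N s -> homotopic_seq s t.
Proof.
(* Since [PathSym] reverses the direction, the induction has to carry the equivalence of the two
   membership statements along. *)
move=> h; suff [e] : (polyline_in N s <-> polyline_in N t) /\ (polyline_in N s -> homotopic_seq s t) by [].
elim: h => {s t} [p A B C q hN|s|s t _ [e h]|s t u _ [e h] _ [e' h']].
- split; first exact: polyline_path_cancel.
  move=> hp; set s := _ ++ _; set t := _ ++ _.
  have sB : cyc s = cyc (B :: C :: q ++ rcons p A).
    by rewrite /s -cat_rcons cyc_cat.
  have tC : cyc (C :: q ++ rcons p A) = cyc t.
    by rewrite /t -[in RHS]cat_rcons [RHS]cyc_cat.
  apply: homotopic_seq_trans (homotopic_seq_cyc hp sB) _.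
  have hC : triangle_hull (last C (q ++ rcons p A)) B C `<=` N by rewrite last_cat last_rcons.
  have h := homotopic_seq_cancel (polyline_cyc sB hp) hC.
  by apply: homotopic_seq_trans (h) (homotopic_seq_cyc _ tC); have [] := homotopic_seq_polyline h.
- by split=> // hs; exact: homotopic_seq_cyc.
- split; first by rewrite e.
  by move=> ht; exact/homotopic_seq_sym/(h (iffRL e ht)).
- split; first by rewrite e.
  by move=> hs; exact: homotopic_seq_trans (h hs) (h' (iffLR e hs)).
Qed.

End PathHomotopy.

(** * Homotopy invariance of words, and agreement with the Poincare word *)

Section PathWords.
Context {R : realType} {n : nat}.
Local Notation point := 'rV[R]_2.
Variables (P v : 'I_n -> point).
Implicit Types (A B C X Y Z : point) (K : set point) (i j : 'I_n) (s t p q : seq point).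
Hypothesis v_neq0 : forall i, v i != 0.
Hypothesis ray_disjoint : forall i j X, i != j -> ray P v i X -> ~ ray P v j X.
Local Notation N := (~` range P).
Local Notation cut_word := (cut_word P v).

Lemma avoids_sites K i : K `<=` N -> ~ K (P i).
Proof. by move=> KN /KN; apply; exists i. Qed.

Lemma cut_word_hull A B C : triangle_hull A B C `<=` N ->
  red (cut_word A B ++ cut_word B C) = red (cut_word A C).
Proof.
move=> hN; have [] := @cut_word_triangle _ _ P v v_neq0 ray_disjoint _ (@convex_hull _ A B C)
  (fun i => avoids_sites hN) A B C (hull1 _ _ _) (hull2 _ _ _) (hull3 _ _ _).
move=> p [q [r [-> -> ->]]]; rewrite -catA; apply: red_cat => //; exact: red_mulV.
Qed.

Lemma cut_word_refl A : cut_word A A = [::].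
Proof.
rewrite /cut_word (eq_filter (a2 := pred0)) ?filter_pred0 // => i.
by rewrite /cuts eqxx.
Qed.

(** Apply the triangle relation to the degenerate triangle [A B A]: the word of [AA] is empty, so
    [p] and [r] are empty and only [q] and its inverse remain. *)
Lemma cut_word_sym A B : segment A B `<=` N -> cut_word B A = inv_word (cut_word A B).
Proof.
rewrite -hull_ABA => hN.
have [] := @cut_word_triangle _ _ P v v_neq0 ray_disjoint _ (@convex_hull _ A B A)
  (fun i => avoids_sites hN) A B A (hull1 _ _ _) (hull2 _ _ _) (hull3 _ _ _).
move=> p [q [r [-> ->]]]; rewrite cut_word_refl.
by case: p => [|x p] //=; case: r => [|y r] // _; rewrite cats0.
Qed.

Definition path_word s : seq (letter n) :=
  if s is A :: s' then flatten (pairmap cut_word A s') else [::].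

Lemma path_word_cons A B s : path_word (A :: B :: s) = cut_word A B ++ path_word (B :: s).
Proof. by []. Qed.

Lemma path_word_cat p A q : path_word (p ++ A :: q) = path_word (rcons p A) ++ path_word (A :: q).
Proof. by elim: p => //= B [|C p] ih; rewrite /= ?cats0 // -catA -ih. Qed.

Lemma path_word_rcons A s B :
  path_word (rcons (A :: s) B) = path_word (A :: s) ++ cut_word (last A s) B.
Proof. by elim: s A => [|C s ih] A /=; rewrite ?cats0 // -catA -ih. Qed.

Lemma path_word_rev A s : path_in N A s -> path_word (rev (A :: s)) = inv_word (path_word (A :: s)).
Proof.
elim: s A => // B s ih A [AB hs]; rewrite path_word_cons inv_word_cat -ih // 2!rev_cons.
by rewrite -(cats1 _ A) cat_rcons path_word_cat -rev_cons path_word_cons cats0 cut_word_sym.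
Qed.

Lemma path_word_homotopic s t : path_homotopic N s t -> red (path_word s) = red (path_word t).
Proof.
elim=> // [p A B C q hN|s' t' u _ -> _ ->] //.
rewrite path_word_cat [in RHS]path_word_cat; apply: red_cat => //.
by rewrite !path_word_cons catA; apply: red_cat => //; exact: cut_word_hull.
Qed.

Definition closed_word s : seq (letter n) :=
  flatten [seq cut_word e.1 e.2 | e <- cyclic_pairs s].

Lemma closed_word_cons A s : closed_word (A :: s) = path_word (rcons (A :: s) A).
Proof.
rewrite /closed_word cyclic_pairs_cons rcons_cons /path_word; congr flatten.
by move: {2 4}A => B; elim: s A => //= C s ih A; rewrite ih.
Qed.

Lemma closed_word_cyc s t : cyc s = cyc t -> conj_words (closed_word s) (closed_word t).
Proof.
move=> /cyc_eqP[k <-]; apply: conj_cyc; apply/cyc_eqP.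
rewrite /closed_word rot_cyclic_pairs map_rot; set ss := map _ _.
exists (size (flatten (take k ss))).
by rewrite -{2}(cat_take_drop k ss) flatten_cat rot_size_cat /rot flatten_cat.
Qed.

Lemma closed_word_homotopic (l l' : polyline N) : homotopic l l' ->
  conj_words (closed_word (vertices l)) (closed_word (vertices l')).
Proof.
move: l l'; apply: (@homotopic_ind _ N (fun s t => conj_words (closed_word s) (closed_word t))).
- exact: closed_word_cyc.
- by move=> s t; exact: conj_sym.
- by move=> s t u; exact: conj_trans.
move=> B C s _ hN; rewrite !closed_word_cons !rcons_cons path_word_cons.
(* The rotation moves the word of the segment leaving [B] behind that of the segment arriving at
   [B], where the triangle relation applies to the pair. *)
apply: conj_trans (conj_rot _ _) _.
apply: conj_red; rewrite -!rcons_cons !path_word_rcons -catA.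
by apply: red_cat => //; exact: cut_word_hull.
Qed.

Lemma homotopic_seq_closed_word s t : homotopic_seq N s t -> conj_words (closed_word s) (closed_word t).
Proof.
move=> [l [l' [hl hl' h]]].
apply: (@conj_trans _ (closed_word (vertices l))).
  by apply: closed_word_cyc; rewrite -hl cyc_reprK.
apply: conj_trans (closed_word_homotopic h) _.
by apply: closed_word_cyc; rewrite -hl' cyc_reprK.
Qed.

(** By [dev0_ray], an endpoint on the line carrying the ray would lie on the ray itself. So both
    endpoints are strictly off the line, and the crossing is transversal. *)
Lemma crossed_ray_sides A B X i : segment A B `<=` N -> ~ ray P v i A -> ~ ray P v i B ->
  segment A B X -> ray P v i X ->
  (dev P v i A < 0 /\ 0 < dev P v i B) \/ (0 < dev P v i A /\ dev P v i B < 0).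
Proof.
move=> hN rA rB kX rX.
have ai : active P v (segment A B) i by apply/asboolP; exists X.
have dev0 := @dev0_ray _ _ P v v_neq0 _ (@convex_segment R A B) (fun i => avoids_sites hN) i _ ai.
have a0 : dev P v i A <> 0.
  by move=> h; apply: rA; apply: dev0 => //; exists 0; rewrite lexx ler01 scale0r addr0.
have b0 : dev P v i B <> 0.
  by move=> h; apply: rB; apply: dev0 => //; exists 1; rewrite lexx ler01 scale1r addrC subrK.
move: kX rX => [t [ht ->]] /dev_ray; rewrite -/(lerp A B t) dev_lerp => e.
have [la|la|//] := ltgtP (dev P v i A) 0; have [lb|lb|//] := ltgtP (dev P v i B) 0; nra.
Qed.

Lemma segment_cut_word A B : (forall i, ~ ray P v i A) -> (forall i, ~ ray P v i B) ->
  segment A B `<=` N -> segment_word P (ray P v) A B = cut_word A B.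
Proof.
move=> rA rB hN.
have K_avoids i : ~ segment A B (P i) := avoids_sites hN.
have K_convex := @convex_segment R A B.
have kA : segment A B A by exists 0; rewrite lexx ler01 scale0r addr0.
have kB : segment A B B by exists 1; rewrite lexx ler01 scale1r addrC subrK.
have dev0 i := @dev0_ray _ _ P v v_neq0 _ K_convex K_avoids i.
have activeE i : `[< segment A B `&` ray P v i !=set0 >] = active P v (segment A B) i by [].
have signs i : active P v (segment A B) i ->
    (dev P v i A < 0 /\ 0 < dev P v i B) \/ (0 < dev P v i A /\ dev P v i B < 0).
  by move=> /asboolP[X [kX rX]]; exact: (crossed_ray_sides hN (rA i) (rB i) kX rX).
have cutsE' i : cuts P v A B i = active P v (segment A B) i.
  rewrite (cutsE v_neq0 K_convex) //; apply: andb_idr => /signs; rewrite /side.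
  by case=> -[ha hb]; [rewrite ha (lt_gtF hb) | rewrite hb (lt_gtF ha)].
have timeE i : active P v (segment A B) i -> crossing_time (ray P v) A B i = cut_time P v A B i.
  move=> ai; move: (ai); rewrite -cutsE' /cuts => /andP[hs _].
  have [ht h0] := cut_timeP hs.
  (* The affine function [dev i] has opposite signs at the two ends, so its zero on the segment is
     unique and [xget] can only return [cut_time]. *)
  rewrite /crossing_time; case: xgetP => [t _ [ht' /dev_ray]|].
    rewrite -/(lerp A B t); move: h0; rewrite !dev_lerp; move: (cut_time _ _ _ _ _) => t'.
    by case: (signs _ ai) => -[]; nra.
  move=> /(_ (cut_time P v A B i)); case; split => //; apply: dev0 => //.
  by exists (cut_time P v A B i).
rewrite /segment_word /crossings /cut_word.
rewrite (eq_filter (a2 := cuts P v A B)); last by move=> i; rewrite activeE cutsE'.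
rewrite (@sort_key_eq _ _ (cut_time P v A B)).
- apply/eq_in_map => i; rewrite mem_sort mem_filter => /andP[ci _]; congr (_, _).
  have ai : active P v (segment A B) i by rewrite -cutsE'.
  move/asboolP: (ai) => [X [kX [t [t0 e]]]].
  have tn0 : t != 0.
    by apply/eqP => tz; apply: (K_avoids i); move: kX; rewrite e tz scale0r addr0.
  have tp : 0 < t by rewrite lt_neqAle eq_sym tn0.
  (* The crossing point is both [A + u (B - A)] and [P i + t v_i]. Going back from it to [P i]
     subtracts [t v_i] with [t] positive, so the orientation of [A B (P i)] is the sign of the
     change of [dev i]. *)
  have ecw : cross (B - A) (P i - A) = t * (dev P v i B - dev P v i A).
    move: kX e => [u [_ ->]] e.
    have := congr1 (fun X : point => X 0 0) e; have := congr1 (fun X : point => X 0 1) e.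
    rewrite /= /dev /cross !mxE => e1 e0.
    have -> : P i 0 0 = A 0 0 + u * (B 0 0 - A 0 0) - t * v i 0 0 by lra.
    have -> : P i 0 1 = A 0 1 + u * (B 0 1 - A 0 1) - t * v i 0 1 by lra.
    by ring.
  rewrite /clockwise ecw asboolb /side; apply/idP/idP; case: (signs _ ai) => -[]; nra.
- exact: (cut_time_inj v_neq0 ray_disjoint K_convex K_avoids).
- by move=> i j; rewrite !mem_filter !cutsE' => /andP[ai _] /andP[aj _]; rewrite !timeE.
Qed.

End PathWords.

(** * General position *)

Section Small.
Context {R : realType}.
Implicit Types Q : R -> Prop.

(** The filter of right neighbourhoods of 0 in elementary form; finitely many perturbation
    conditions can then be met by one parameter. *)
Definition for_small Q := exists e : R, 0 < e /\ forall s, 0 < s < e -> Q s.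

Lemma for_small_ex Q : for_small Q -> exists s, 0 < s /\ Q s.
Proof. by move=> [e [e0 h]]; exists (e / 2); split; [lra | apply: h; lra]. Qed.

Lemma for_small_sub Q Q' : (forall s, 0 < s -> Q s -> Q' s) -> for_small Q -> for_small Q'.
Proof. by move=> QQ' [e [e0 h]]; exists e; split=> // s se; apply: QQ'; [lra | exact: h]. Qed.

Lemma for_small_and Q Q' : for_small Q -> for_small Q' -> for_small (fun s => Q s /\ Q' s).
Proof.
move=> [e [e0 h]] [e' [e'0 h']]; exists (Num.min e e'); split; first by rewrite lt_min e0.
by move=> s; rewrite lt_min => /andP[s0 /andP[se se']]; split; [apply: h | apply: h'];
  apply/andP.
Qed.

Lemma for_small_all (T : eqType) (l : seq T) (Q : T -> R -> Prop) :
  {in l, forall x, for_small (Q x)} -> for_small (fun s => {in l, forall x, Q x s}).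
Proof.
elim: l => [_|x l ih h]; first by exists 1; split=> // s _ y; rewrite in_nil.
have hl : {in l, forall y, for_small (Q y)} by move=> y yl; apply: h; rewrite inE yl orbT.
apply: for_small_sub (for_small_and (h x (mem_head _ _)) (ih hl)).
by move=> s _ [hx hs] y; rewrite inE => /orP[/eqP->|/hs].
Qed.

Lemma for_small_forall (T : finType) (Q : T -> R -> Prop) :
  (forall x, for_small (Q x)) -> for_small (fun s => forall x, Q x s).
Proof.
move=> h; have := @for_small_all _ (enum T) Q (fun x _ => h x).
by apply: for_small_sub => s _ hs x; apply: hs; rewrite mem_enum.
Qed.

Lemma for_small_lt (a b c : R) : a < b -> for_small (fun s => a + s * c < b).
Proof.
move=> ab; have [c0|c0] := lerP c 0; first by exists 1; split=> // s hs; nra.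
exists ((b - a) / c); split; first by rewrite divr_gt0 // subr_gt0.
by move=> s /andP[s0]; rewrite ltr_pdivlMr // => h; lra.
Qed.

Lemma for_small_neq0 (a c : R) : c != 0 -> for_small (fun s => a + s * c != 0).
Proof.
move=> c0; have [->|a0] := eqVneq a 0.
  by exists 1; split=> // s /andP[s0 _]; rewrite add0r mulf_neq0 // gt_eqF.
have [a1|a1|/eqP] := ltgtP a 0; last by rewrite (negPf a0).
  by apply: for_small_sub (for_small_lt c a1) => s _ h; rewrite lt_eqF.
have na : - a < 0 by lra.
by apply: for_small_sub (for_small_lt (- c) na) => s _ h; rewrite gt_eqF //; lra.
Qed.

Lemma exists_gt (l : seq R) : exists t, {in l, forall x, x < t}.
Proof.
elim: l => [|x l [t ht]]; first by exists 0 => x; rewrite in_nil.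
exists (Num.max (x + 1) t) => y; rewrite inE => /orP[/eqP->|/ht yt].
  by rewrite lt_max ltrDl ltr01.
by rewrite lt_max yt orbT.
Qed.

End Small.

(** * Separation by linear forms, and perturbation into general position *)

Section Plane.
Context {R : realType}.
Local Notation point := 'rV[R]_2.
Implicit Types (A B C X Y Z u w d : point) (K : set point).

Definition mkpt (a b : R) : point := \row_j (if j == 0 then a else b).

Lemma mkpt0 a b : mkpt a b 0 0 = a. Proof. by rewrite mxE. Qed.
Lemma mkpt1 a b : mkpt a b 0 1 = b. Proof. by rewrite mxE. Qed.

Lemma neq0_coord u : u != 0 -> (u 0 0 != 0) || (u 0 1 != 0).
Proof.
apply: contraNT; rewrite negb_or !negbK => /andP[/eqP a /eqP b].
by apply/eqP/point_eq; rewrite !mxE.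
Qed.

(** Take the direction [(1, t)] with [t] larger than all slopes of the list; it is not vertical
    either, which settles the vectors of abscissa 0. *)
Lemma exists_transversal (l : seq point) : {in l, forall u, u != 0} ->
  exists d, {in l, forall u, cross u d != 0}.
Proof.
move=> l0; have [t ht] := exists_gt [seq u 0 1 / u 0 0 | u <- l].
exists (mkpt 1 t) => u ul; rewrite /cross mkpt0 mkpt1 mulr1.
apply/eqP => e; have := ht _ (map_f (fun u : point => u 0 1 / u 0 0) ul).
have [u0|u0] := eqVneq (u 0 0) 0.
  by move: (neq0_coord (l0 _ ul)); rewrite u0 eqxx /=; move: e; rewrite u0 mul0r sub0r => /eqP;
    rewrite oppr_eq0 => ->.
have -> : u 0 1 = t * u 0 0 by lra.
by rewrite mulfK // ltxx.
Qed.

Lemma cross_parallel u X : u != 0 -> cross u X = 0 -> exists t, X = t *: u.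
Proof.
rewrite /cross => /neq0_coord/orP[h|h] e.
  by exists (X 0 0 / u 0 0); apply: point_eq; rewrite !mxE; [rewrite divfK | apply: (mulfI h);
    rewrite mulrA mulrCA divff // mulr1; lra].
by exists (X 0 1 / u 0 1); apply: point_eq; rewrite !mxE; [apply: (mulfI h);
  rewrite mulrA mulrCA divff // mulr1; lra | rewrite divfK].
Qed.

Lemma crossD u X Y : cross u (X + Y) = cross u X + cross u Y.
Proof. by rewrite /cross !mxE; ring. Qed.

Lemma crossZ u (t : R) X : cross u (t *: X) = t * cross u X.
Proof. by rewrite /cross !mxE; ring. Qed.

(* Convexity of the lexicographic order given by two linear forms. *)
Lemma hull_lex u w X A B C :
  (forall Y, Y \in [:: A; B; C] ->
     cross u Y < cross u X \/ (cross u Y = cross u X /\ cross w Y < cross w X)) ->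
  ~ triangle_hull A B C X.
Proof.
move=> h [a [b [c [a0 b0 c0 e eX]]]].
have eq_u z : cross z X = a * cross z A + b * cross z B + c * cross z C.
  by rewrite eX !crossD !crossZ.
have := eq_u u; have := eq_u w.
have := h A; have := h B; have := h C; rewrite !inE !eqxx !orbT => /(_ isT) + /(_ isT) + /(_ isT) +.
move: (cross u A) (cross u B) (cross u C) (cross u X) (cross w A) (cross w B) (cross w C) (cross w X).
move=> uA uB uC uX wA wB wC wX hC hB hA ew eu.
have {}eu : a * (uX - uA) + b * (uX - uB) + c * (uX - uC) = 0 by nra.
have {}ew : a * (wX - wA) + b * (wX - wB) + c * (wX - wC) = 0 by nra.
have pA : 0 <= a * (uX - uA) by apply: mulr_ge0 => //; case: hA => [|[]]; lra.
have pB : 0 <= b * (uX - uB) by apply: mulr_ge0 => //; case: hB => [|[]]; lra.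
have pC : 0 <= c * (uX - uC) by apply: mulr_ge0 => //; case: hC => [|[]]; lra.
have zero k p q : 0 <= k -> k * (uX - p) = 0 -> p < uX \/ (p = uX /\ q < wX) ->
    k = 0 \/ 0 < wX - q.
  move=> k0 /eqP; rewrite mulf_eq0 => /orP[/eqP|/eqP h1 [|[_ h2]]]; [by left|lra|right; lra].
have zA : a = 0 \/ 0 < wX - wA by apply: zero hA => //; lra.
have zB : b = 0 \/ 0 < wX - wB by apply: zero hB => //; lra.
have zC : c = 0 \/ 0 < wX - wC by apply: zero hC => //; lra.
have ge k q : 0 <= k -> k = 0 \/ 0 < wX - q -> 0 <= k * (wX - q).
  by move=> k0 [->|?]; [rewrite mul0r | apply: mulr_ge0 => //; lra].
have gA := ge _ _ a0 zA; have gB := ge _ _ b0 zB; have gC := ge _ _ c0 zC.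
have zero' k q : k * (wX - q) = 0 -> k = 0 \/ 0 < wX - q -> k = 0.
  by move=> /eqP; rewrite mulf_eq0 => /orP[/eqP|/eqP h1 []] //; lra.
have a1 := zero' _ _ (ltac:(lra) : a * (wX - wA) = 0) zA.
have b1 := zero' _ _ (ltac:(lra) : b * (wX - wB) = 0) zB.
have c1 := zero' _ _ (ltac:(lra) : c * (wX - wC) = 0) zC.
by lra.
Qed.

Lemma hull_separate u X A B C : cross u A < cross u X -> cross u B < cross u X ->
  cross u C < cross u X -> ~ triangle_hull A B C X.
Proof.
by move=> hA hB hC; apply: (@hull_lex u 0) => Y; rewrite !inE => /or3P[] /eqP->; left.
Qed.

Definition quarter_turn u : point := mkpt (- u 0 1) (u 0 0).

Lemma cross_quarter_turn u X : cross (quarter_turn u) X = - (u 0 0 * X 0 0 + u 0 1 * X 0 1).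
Proof. by rewrite /cross mkpt0 mkpt1; ring. Qed.

Lemma sqr_norm_gt0 u : u != 0 -> 0 < u 0 0 * u 0 0 + u 0 1 * u 0 1.
Proof.
move=> /neq0_coord/orP[] h; [apply: ltr_wpDr | apply: ltr_wpDl];
by rewrite -?expr2 ?sqr_ge0 // exprn_even_gt0 //= h.
Qed.

(** Every linear form is some [cross u]. Off the line [AB] the form vanishing on its direction
    separates, up to sign; on that line, or if [A = B], a scalar product does, obtained through
    [quarter_turn]. *)
Lemma segment_separate X A B : ~ segment A B X ->
  exists u, cross u A < cross u X /\ cross u B < cross u X.
Proof.
move=> h; have [AB|AB] := eqVneq A B.
  have XA : X - A != 0.
    by rewrite subr_eq0; apply/eqP => e; apply: h; exists 0; rewrite lexx ler01 scale0r addr0.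
  exists (- quarter_turn (X - A)); rewrite -AB.
  have := sqr_norm_gt0 XA; rewrite /cross !mxE /= => ?; split; nra.
have BA : B - A != 0 by rewrite subr_eq0 eq_sym.
have [e|e] := eqVneq (cross (B - A) (X - A)) 0.
  have [t et] := cross_parallel BA e.
  have eX : X = A + t *: (B - A) by rewrite -et addrC subrK.
  have [t0|t0] := ltP t 0.
    exists (quarter_turn (B - A)); rewrite eX.
    have := sqr_norm_gt0 BA; rewrite !cross_quarter_turn !mxE => ?; split; nra.
  have [t1|t1] := ltP 1 t.
    exists (- quarter_turn (B - A)); rewrite eX.
    have := sqr_norm_gt0 BA; rewrite /cross !mxE /= => ?; split; nra.
  by case: h; exists t; rewrite t0 t1.
have [lt|gt|eq0] := ltgtP (cross (B - A) (X - A)) 0; last by rewrite eq0 eqxx in e.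
  by exists (A - B); move: lt; rewrite /cross !mxE => ?; split; nra.
by exists (B - A); move: gt; rewrite /cross !mxE => ?; split; nra.
Qed.

Section Sites.
Context {n : nat}.
Variables (P v : 'I_n -> point).
Hypothesis v_neq0 : forall i, v i != 0.
Local Notation N := (~` range P).

Lemma subset_sites K : (forall i, ~ K (P i)) -> K `<=` N.
Proof. by move=> h X kX [i _ e]; apply: (h i); rewrite e. Qed.

Lemma for_small_hull A B d : segment A B `<=` N ->
  for_small (fun s => triangle_hull A B (B + s *: d) `<=` N).
Proof.
move=> hN; apply: for_small_sub (fun s _ => @subset_sites _) _.
apply: for_small_forall => i.
have [u [uA uB]] := segment_separate (avoids_sites (i := i) hN).
apply: for_small_sub (for_small_lt (cross u d) uB) => s _ hs.
by apply: (@hull_separate u) => //; rewrite crossD crossZ.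
Qed.

Lemma for_small_off_rays B d : (forall i, cross (v i) d != 0) ->
  for_small (fun s => forall i, ~ ray P v i (B + s *: d)).
Proof.
move=> hd; apply: for_small_forall => i.
apply: for_small_sub (for_small_neq0 (dev P v i B) (hd i)) => s _ /eqP h /dev_ray e; apply: h.
by rewrite -e /dev /cross !mxE; ring.
Qed.

Lemma exists_ray_transversal : exists d, forall i, cross (v i) d != 0.
Proof.
have [|d hd] := @exists_transversal [seq v i | i <- enum 'I_n].
  by move=> u /mapP[i _ ->].
by exists d => i; apply: hd; rewrite map_f ?mem_enum.
Qed.

(** The nearby point [B'] is inserted before [B], in a thin triangle on the segment arriving at [B];
    then [B] is removed through a thin triangle on the segment leaving it. *)
Lemma perturb_vertex B s : polyline_in N (B :: s) ->
  exists B', (forall i, ~ ray P v i B') /\ homotopic_seq N (B :: s) (B' :: s).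
Proof.
move=> hB; have [d hd] := exists_ray_transversal.
move/polyline_inE: (hB); rewrite -cats1 path_in_cat /= => -[hs [hl _]].
have hh : segment (head B s) B `<=` N.
  case: (s) hs hl => //= C s' [hBC _] _; rewrite -hull_ABA => X hX; apply: hBC.
  by rewrite -hull_ABA; move: X hX; apply: hull_sub;
    [exact: convex_hull|exact: hull2|exact: hull1|exact: hull2].
have := for_small_and (for_small_off_rays B hd)
  (for_small_and (for_small_hull d hl) (for_small_hull d hh)).
move/for_small_ex => [e [_ [hr [h1 h2]]]]; move: (B + e *: d) hr h1 h2 => B' hr h1 h2.
exists B'; split=> //.
have hB' : polyline_in N (B' :: B :: s).
  apply/polyline_inE; rewrite /= -cats1 path_in_cat /=.
  by repeat split => //; [apply: (hull_segment h2) | apply: (hull_segment h1)];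
    by [exact: hull1 | exact: hull2 | exact: hull3].
have step1 : homotopic_seq N (B' :: B :: s) (B :: s).
  apply: homotopic_seq_cancel => //; apply: subset_trans h1; apply: hull_sub;
    [exact: convex_hull|exact: hull1|exact: hull3|exact: hull2].
apply: homotopic_seq_trans (homotopic_seq_sym step1) _.
have c1 : cyc (B' :: B :: s) = cyc (B :: rcons s B').
  by rewrite -rcons_cons -cats1 cyc_cat.
apply: homotopic_seq_trans (homotopic_seq_cyc hB' c1) _.
have c2 : cyc (rcons s B') = cyc (B' :: s) by rewrite -cats1 cyc_cat.
have := polyline_cyc c1 hB'.
case: s h2 {hB hs hl hh h1 hB' step1 c1} c2 => [|C s] /= h2 c2 hB''.
  apply: homotopic_seq_cancel => //; apply: subset_trans h2; apply: hull_sub;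
    [exact: convex_hull|exact: hull3|exact: hull2|exact: hull3].
have h : homotopic_seq N (B :: C :: rcons s B') (C :: rcons s B').
  apply: homotopic_seq_cancel => //; rewrite last_rcons; apply: subset_trans h2; apply: hull_sub;
    [exact: convex_hull|exact: hull3|exact: hull2|exact: hull1].
apply: homotopic_seq_trans (h) _; apply: homotopic_seq_cyc c2.
by have [] := homotopic_seq_polyline h.
Qed.

Lemma perturb_polyline s : polyline_in N s ->
  exists t, homotopic_seq N s t /\ forall A, A \in t -> forall i, ~ ray P v i A.
Proof.
suff gen p q : polyline_in N (p ++ q) -> (forall A, A \in p -> forall i, ~ ray P v i A) ->
    exists t, homotopic_seq N (p ++ q) t /\ forall A, A \in t -> forall i, ~ ray P v i A.
  by move=> hs; apply: (gen [::]).
elim: q p => [|B q ih] p hpq hp.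
  by exists p; rewrite cats0 in hpq *; split=> //; exact: homotopic_seq_cyc.
have c1 : cyc (p ++ B :: q) = cyc (B :: q ++ p) by rewrite cyc_cat.
have [B' [hr h]] := perturb_vertex (polyline_cyc c1 hpq).
have c2 : cyc (B' :: q ++ p) = cyc (rcons p B' ++ q) by rewrite cat_rcons [RHS]cyc_cat.
have [_ hB'] := homotopic_seq_polyline h.
have [||t [ht tr]] := ih (rcons p B'); first exact: polyline_cyc c2 hB'.
  by move=> A; rewrite mem_rcons inE => /orP[/eqP->|/hp].
exists t; split=> //; apply: homotopic_seq_trans (homotopic_seq_cyc hpq c1) _.
by apply: homotopic_seq_trans (h) _; apply: homotopic_seq_trans (homotopic_seq_cyc hB' c2) ht.
Qed.

End Sites.
End Plane.

(** * Generation by loops around the sites *)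

Section PathMoves.
Context {R : realType}.
Local Notation point := 'rV[R]_2.
Variable N : set point.
Implicit Types (A B C : point) (s t p q : seq point).

Lemma hull_AAB A B : segment A B `<=` N -> triangle_hull A A B `<=` N.
Proof.
move=> h; apply: subset_trans h; rewrite -hull_ABA.
by apply: hull_sub; [exact: convex_hull | exact: hull1 | exact: hull1 | exact: hull2].
Qed.

Lemma path_backtrack p A B q C : segment A B `<=` N -> segment A C `<=` N ->
  path_homotopic N (p ++ A :: B :: A :: C :: q) (p ++ A :: C :: q).
Proof.
move=> AB AC; apply: (@PathTrans _ _ (p ++ A :: A :: C :: q)).
  by apply: PathCancel; rewrite hull_ABA.
by apply: PathCancel; exact: hull_AAB.
Qed.

Lemma segment_sym A B : segment A B = segment B A.
Proof.
by rewrite -(hull_ABA A B) -(hull_ABA B A); apply/seteqP; split; apply: hull_sub;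
  do ?[exact: convex_hull | exact: hull1 | exact: hull2].
Qed.

Lemma homotopic_seq_dup A s : polyline_in N (A :: s) -> homotopic_seq N (A :: A :: s) (A :: s).
Proof.
move=> hA; move/polyline_inE: (hA); rewrite -cats1 path_in_cat /= => -[hs [hl _]].
have hAA : segment A A `<=` N.
  by move=> X [t [_ ->]]; rewrite subrr scaler0 addr0; apply: hl; exists 1;
    rewrite ler01 lexx scale1r addrC subrK.
apply: homotopic_seq_cancel; last first.
  by move=> X /triangle_hull_rev; apply: hull_AAB; rewrite segment_sym.
by apply/polyline_inE; rewrite /= -cats1 path_in_cat.
Qed.

End PathMoves.

Section Generation.
Context {R : realType} {n : nat}.
Local Notation point := 'rV[R]_2.
Variables (P : 'I_n -> point) (f g : point).
Implicit Types (A B C X Y Z : point) (i j k : 'I_n) (s t p q : seq point) (w u : seq (letter n)).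
Local Notation N := (~` range P).
Local Notation x := (cross f).
Local Notation y := (cross g).
Variable pt : R -> R -> point.
Hypothesis x_pt : forall a b, x (pt a b) = a.
Hypothesis y_pt : forall a b, y (pt a b) = b.
Hypothesis xy_inj : forall X Y, x X = x Y -> y X = y Y -> X = Y.
Hypothesis x_sites : forall i j, i != j -> x (P i) != x (P j).
Variable O : point.
Hypothesis O_below : forall i, y O < y (P i).
Variable e : R.
Hypothesis e_gt0 : 0 < e.
Hypothesis e_small : forall i j, i != j -> e < `|x (P i) - x (P j)|.

(** As [e] is smaller than every gap between abscissas, the triangle formed by the two feet and the
    top of a site surrounds that site and no other. *)
Definition left_foot i := pt (x (P i) - e) (y O).
Definition right_foot i := pt (x (P i) + e) (y O).
Definition site_top i := pt (x (P i)) (y (P i) + 1).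

Lemma x_left i : x (left_foot i) = x (P i) - e. Proof. exact: x_pt. Qed.
Lemma y_left i : y (left_foot i) = y O. Proof. exact: y_pt. Qed.
Lemma x_right i : x (right_foot i) = x (P i) + e. Proof. exact: x_pt. Qed.
Lemma y_right i : y (right_foot i) = y O. Proof. exact: y_pt. Qed.
Lemma x_top i : x (site_top i) = x (P i). Proof. exact: x_pt. Qed.
Lemma y_top i : y (site_top i) = y (P i) + 1. Proof. exact: y_pt. Qed.
Let coordE := (x_left, y_left, x_right, y_right, x_top, y_top, x_pt, y_pt).

Definition around (a : letter n) : seq point :=
  if a.2 then [:: left_foot a.1; site_top a.1; right_foot a.1] else [:: right_foot a.1;
    site_top a.1; left_foot a.1].

(** The same walk from [O] to [O] is cut into blocks in two ways: [std_path] puts the base point at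
    the end of each block, [std_path_from] at the beginning. *)
Definition std_path w : seq point := flatten [seq rcons (around a) O | a <- w].
Definition std_path_from w : seq point := flatten [seq O :: around a | a <- w].

Lemma std_path_rcons w : O :: std_path w = rcons (std_path_from w) O.
Proof.
elim: w => //= a w ih.
by rewrite /std_path /= -/(std_path w) cat_rcons ih rcons_cat.
Qed.

Lemma std_path_last w : last O (std_path w) = O.
Proof. by rewrite -[LHS]/(last O (O :: std_path w)) std_path_rcons last_rcons. Qed.

Lemma std_path_cat u w : std_path (u ++ w) = std_path u ++ std_path w.
Proof. by rewrite /std_path map_cat flatten_cat. Qed.

Lemma rev_std_path w : rev (O :: std_path w) = O :: std_path (inv_word w).
Proof.
rewrite std_path_rcons rev_rcons; congr (_ :: _).
elim: w => // a w ih; rewrite -cat1s inv_word_cat std_path_cat -ih /std_path_from /=.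
rewrite rev_cons rev_cat -cats1 -catA; congr (_ ++ _).
by case: a => i []; rewrite /inv_letter /around /= ?cats0.
Qed.

(* Each point [A] of [N] is joined to [O] through a point of the horizontal  *)
(* line through [O]: straight below [A], or, if a site is in the way, a      *)
(* little to the left of that site.                                          *)
Definition foot A : point :=
  if [pick i | (x A == x (P i)) && (y (P i) < y A)] is Some i then left_foot i else pt (x A) (y O).

Variant foot_spec A : point -> Prop :=
| FootAbove i of x A = x (P i) & y (P i) < y A : foot_spec A (left_foot i)
| FootBelow of (forall i, x A = x (P i) -> y A < y (P i)) : foot_spec A (pt (x A) (y O)).

Lemma footP A : N A -> foot_spec A (foot A).
Proof.
move=> NA; rewrite /foot; case: pickP => [i /andP[/eqP h1 h2]|h]; first exact: FootAbove.
apply: FootBelow => i xi; have := h i; rewrite xi eqxx /= => /negbT; rewrite -leNgt le_eqVlt.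
by case/orP => // /eqP yi; case: NA; exists i => //; exact/esym/xy_inj.
Qed.

(** The common test for emptiness of triangles: [sx] is 1 or -1 as the triangle is to the left or
    right of the site, and [sy] is 1 or -1 as its vertices on the vertical through the site are
    below or above it. *)
Lemma avoid_site i A B C (sx sy : R) :
  (forall Y, Y \in [:: A; B; C] -> 0 < sx * (x (P i) - x Y) \/
     (x Y = x (P i) /\ 0 < sy * (y (P i) - y Y))) -> ~ triangle_hull A B C (P i).
Proof.
move=> h; apply: (@hull_lex _ (sx *: f) (sy *: g)) => Y /h.
have crossZl (z X : point) (a : R) : cross (a *: z) X = a * cross z X by rewrite /cross !mxE; ring.
by rewrite !crossZl => -[h1|[-> h2]]; [left; lra | right; split=> //; lra].
Qed.

Lemma hull_below A B C : y A = y O -> y B = y O -> y C = y O -> triangle_hull A B C `<=` N.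
Proof.
move=> hA hB hC; apply: subset_sites => i; have := O_below i => hO.
by apply: (@hull_separate _ g); rewrite ?hA ?hB ?hC.
Qed.

Lemma segment_below A B : y A = y O -> y B = y O -> segment A B `<=` N.
Proof. by rewrite -hull_ABA => hA hB; exact: hull_below. Qed.

Lemma foot_below A : y (foot A) = y O.
Proof. by rewrite /foot; case: pickP => *; rewrite coordE. Qed.

Lemma far i k : i != k -> x (P i) < x (P k) - e \/ x (P k) + e < x (P i).
Proof. by move=> /e_small; rewrite ltr_normr => /orP[]; [right|left]; lra. Qed.

Lemma hull_foot_left k A B : x A = x (P k) -> y (P k) < y A -> x B = x (P k) -> y (P k) < y B ->
  triangle_hull A (left_foot k) B `<=` N.
Proof.
move=> xA yA xB yB; apply: subset_sites => i; have e0 := e_gt0.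
have [->|/far[]h] := eqVneq i k; [apply: (@avoid_site _ _ _ _ 1 (-1))|
  apply: (@avoid_site _ _ _ _ (-1) 1)|apply: (@avoid_site _ _ _ _ 1 1)];
  move=> Y; rewrite !inE => /or3P[] /eqP->; rewrite ?coordE; try (by left; lra); right; split=> //; lra.
Qed.

Lemma hull_foot_right k A B : x A = x (P k) -> y (P k) < y A -> x B = x (P k) -> y (P k) < y B ->
  triangle_hull A (right_foot k) B `<=` N.
Proof.
move=> xA yA xB yB; apply: subset_sites => i; have e0 := e_gt0.
have [->|/far[]h] := eqVneq i k; [apply: (@avoid_site _ _ _ _ (-1) (-1))|
  apply: (@avoid_site _ _ _ _ (-1) 1)|apply: (@avoid_site _ _ _ _ 1 1)];
  move=> Y; rewrite !inE => /or3P[] /eqP->; rewrite ?coordE; try (by left; lra); right; split=> //; lra.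
Qed.

(** No site lies between [A] and [B] on their common vertical. So either both are above the same
    site, unique because abscissas are distinct, or neither is above any. *)
Lemma hull_foot A B : N A -> N B -> segment A B `<=` N -> x A = x B ->
  foot A = foot B /\ triangle_hull A (foot A) B `<=` N.
Proof.
move=> NA NB AB xAB.
have between k : x A = x (P k) -> (y A < y (P k) /\ y (P k) < y B) \/ (y B < y (P k) /\ y (P k) < y A) -> False.
  move=> xk yk; suff : segment A B (P k) by move/AB; apply; exists k.
  have yAB : y B - y A != 0 by apply/eqP => h; lra.
  exists ((y (P k) - y A) / (y B - y A)); split.
    by case: yk => yk; [|rewrite -[_ / _]opprK -mulrN -invrN -mulNr];
      apply/andP; split; rewrite ?ler_pdivrMr ?divr_ge0 //; lra.
  apply: xy_inj.
    rewrite crossD crossZ (_ : x (B - A) = 0) ?mulr0 ?addr0 //.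
    by rewrite /cross !mxE; move: xAB; rewrite /cross; lra.
  rewrite crossD crossZ (_ : y (B - A) = y B - y A); last by rewrite /cross !mxE; ring.
  by rewrite divfK //; lra.
case: (footP NA) => [i xi yi|hA]; case: (footP NB) => [j xj yj|hB].
- have ij : i = j by apply/eqP/contraT => /x_sites; rewrite -xi -xj xAB eqxx.
  by subst j; split=> //; apply: hull_foot_left.
- by case: (between i) => //; right; split=> //; apply: hB; rewrite -xAB.
- by case: (between j); [rewrite xAB | left; split=> //; apply: hA; rewrite xAB].
- rewrite xAB; split=> //; apply: subset_sites => i; have := O_below i => hO.
  have [h|h|h] := ltgtP (x (P i)) (x A);
    [apply: (@avoid_site _ _ _ _ (-1) 1)|apply: (@avoid_site _ _ _ _ 1 1)|apply: (@avoid_site _ _ _ _ 1 1)];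
    move=> Y; rewrite !inE => /or3P[] /eqP->; rewrite ?coordE -?xAB; try (by left; lra); right; split=> //.
  + by have := hA i (esym h); lra.
  + by lra.
  + by have := hB i; rewrite -xAB => /(_ (esym h)); lra.
Qed.

Lemma segment_foot A : N A -> segment A (foot A) `<=` N.
Proof.
move=> NA; have AA : segment A A `<=` N.
  by move=> X [t [_ ->]]; rewrite subrr scaler0 addr0.
have [_ h] := hull_foot NA NA AA erefl.
by apply: (hull_segment h); [exact: hull1 | exact: hull2].
Qed.

Definition std A w B : seq point := [:: A, foot A & (O :: std_path w) ++ [:: foot B; B]].

Lemma std_vertical A B : N A -> N B -> segment A B `<=` N -> x A = x B ->
  path_homotopic N [:: A; B] (std A [::] B).
Proof.
move=> NA NB AB xAB; have [e1 h] := hull_foot NA NB AB xAB.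
apply: (@PathTrans _ _ [:: A; foot A; B]).
  by apply: PathSym; exact: (@PathCancel _ _ [::] _ _ _ [::] h).
apply: PathSym; rewrite /std /= -e1.
apply: (@path_backtrack _ _ [:: A] _ _ [::]); last by rewrite e1 segment_sym; exact: segment_foot.
by apply: segment_below; rewrite ?foot_below.
Qed.

Lemma std_join A s w C u t B : N C -> path_homotopic N (A :: rcons s C) (std A w C) ->
  path_homotopic N (C :: t) (std C u B) ->
  path_homotopic N (A :: rcons s C ++ t) (std A (w ++ u) B).
Proof.
move=> NC h1 h2; apply: PathTrans (path_homotopic_catr t h1) _.
have -> : std A (w ++ u) B =
    [:: A, foot A & std_path_from w ++ O :: std_path u ++ [:: foot B; B]].
  by rewrite /std std_path_cat -(cat_cons O) std_path_rcons -catA cat_rcons.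
rewrite {1}/std std_path_rcons -cats1 -!catA.
apply: (@PathTrans _ _ ([:: A, foot A & std_path_from w ++ [:: O; foot C]] ++ std C u B)).
  have := path_homotopic_catl ([:: A, foot A & std_path_from w ++ [:: O; foot C]]) h2.
  by rewrite /= -!catA.
rewrite /std /= -!catA /=.
have Of : segment (foot C) O `<=` N by apply: segment_below; rewrite ?foot_below.
apply: (@PathTrans _ _ [:: A, foot A & std_path_from w ++ [:: O, foot C,
  O & std_path u ++ [:: foot B; B]]]).
  have := @path_backtrack _ N (A :: foot A :: std_path_from w ++ [:: O]) (foot C) C (std_path u ++ [:: foot B; B]) O.
  by rewrite /= -!catA; apply=> //; rewrite segment_sym; exact: segment_foot.
(* Removing the last backtrack at [O] requires the segment from [O] to the next vertex to lie in
   [N]; that vertex is on the base line whether [u] is empty or not. *)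
have [X [q [-> hX]]] : exists X q, std_path u ++ [:: foot B; B] = X :: q /\ y X = y O.
  case: u {h2} => [|[i b] u]; first by exists (foot B), [:: B]; rewrite foot_below.
  by case: b; do 2 eexists; split; [reflexivity| rewrite coordE | reflexivity | rewrite coordE].
apply: (@path_backtrack _ N (A :: foot A :: std_path_from w)); first by rewrite segment_sym.
by apply: segment_below.
Qed.

Lemma path_insert p A B C q : triangle_hull A B C `<=` N ->
  path_homotopic N (p ++ A :: C :: q) (p ++ A :: B :: C :: q).
Proof. by move=> h; apply: PathSym; exact: PathCancel. Qed.

Ltac avoid_at a b := apply: (@avoid_site _ _ _ _ a b);
  move=> Y; rewrite !inE => /or3P[] /eqP->; rewrite ?coordE;
  try (by left; lra); right; split=> //; lra.

Lemma left_top k : segment (left_foot k) (site_top k) `<=` N.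
Proof.
have h : triangle_hull (site_top k) (left_foot k) (site_top k) `<=` N.
  by apply: hull_foot_left; rewrite ?x_top ?y_top // ltrDl.
by apply: (hull_segment h); [exact: hull2 | exact: hull1].
Qed.

(** Feet of points above a site are on its left, so a letter appears only when the path goes from
    above a site to its right. In all other cases the path can be pushed straight down. *)
Lemma std_half A C : N A -> N C -> (forall i, x C != x (P i)) ->
  (forall i, ~ (x A < x (P i) < x C) /\ ~ (x C < x (P i) < x A)) ->
  exists w, path_homotopic N [:: A; C] (std A w C).
Proof.
move=> NA NC genC clear_AC; have e0 := e_gt0.
have footC : foot C = pt (x C) (y O).
  by case: (footP NC) => // i xi; have := genC i; rewrite xi eqxx.
have sideC i : x C < x (P i) \/ x (P i) < x C.
  by have := genC i; rewrite neq_lt => /orP[]; [left | right].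
have drop D : y D = y O -> triangle_hull A D C `<=` N -> triangle_hull D (foot C) C `<=` N ->
    path_homotopic N [:: A; C] [:: A; D; O; foot C; C].
  move=> hD h1 h2; apply: PathTrans (path_insert [::] [::] h1) _.
  apply: PathTrans (path_insert [:: A] [::] h2) _.
  by apply: (path_insert [:: A]); apply: hull_below; rewrite ?foot_below.
rewrite /std; case: (footP NA) => [k xk yk|hA].
- have [xCk|xCk] := sideC k.
    exists [::]; apply: drop; rewrite ?footC ?y_left //; apply: subset_sites => i;
    have [hl hr] := clear_AC i; have si := sideC i.
    + have [->|/far[]h] := eqVneq i k; first by avoid_at (1 : R) (-1 : R).
        have {}si : x (P i) < x C.
          by case: si => // s; case: hr; rewrite s; lra.
        by avoid_at (-1 : R) (1 : R).
      by avoid_at (1 : R) (1 : R).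
    + have [->|/far[]h] := eqVneq i k; first by avoid_at (1 : R) (-1 : R).
        have {}si : x (P i) < x C.
          by case: si => // s; case: hr; rewrite s; lra.
        by avoid_at (-1 : R) (1 : R).
      by avoid_at (1 : R) (1 : R).
  exists [:: (k, true)].
  apply: (@PathTrans _ _ [:: A; right_foot k; O; foot C; C]).
    apply: drop; rewrite ?footC ?y_right //; apply: subset_sites => i;
    have [hl hr] := clear_AC i; have si := sideC i.
    + have [->|/far[]h] := eqVneq i k; first by avoid_at (-1 : R) (-1 : R).
        by avoid_at (-1 : R) (1 : R).
      have {}si : x C < x (P i).
        by case: si => // s; case: hl; rewrite s; lra.
      by avoid_at (1 : R) (1 : R).
    + have [->|/far[]h] := eqVneq i k; first by avoid_at (-1 : R) (-1 : R).
        by avoid_at (-1 : R) (1 : R).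
      have {}si : x C < x (P i).
        by case: si => // s; case: hl; rewrite s; lra.
      by avoid_at (1 : R) (1 : R).
  (* The descent by the right foot is changed into one by the left foot: inserting the top and then
     the left foot creates the arc around site [k], and a spike to [O] completes the standard
     loop. *)
  have topk : y (P k) < y (site_top k) by rewrite y_top ltrDl.
  have h1 : triangle_hull A (site_top k) (right_foot k) `<=` N.
    move=> X hX; apply: (hull_foot_right xk yk (x_top k) topk).
    by move: X hX; apply: hull_sub; [exact: convex_hull|exact: hull1|exact: hull3|exact: hull2].
  apply: PathTrans (path_insert [::] _ h1) _.
  apply: PathTrans (path_insert [::] _ (hull_foot_left xk yk (x_top k) topk)) _.
  apply: PathSym; apply: (@path_backtrack _ _ [:: A]); last exact: left_top.
  by apply: segment_below; rewrite ?y_left.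
- exists [::]; apply: drop; rewrite ?footC ?coordE //; apply: subset_sites => i;
    have [hl hr] := clear_AC i; have si := sideC i; have := O_below i => hO.
  + have [h|h|h] := ltgtP (x (P i)) (x A).
    * have {}si : x (P i) < x C by case: si => // s; case: hr; rewrite s h.
      by avoid_at (-1 : R) (1 : R).
    * have {}si : x C < x (P i) by case: si => // s; case: hl; rewrite s h.
      by avoid_at (1 : R) (1 : R).
    * have yA := hA i (esym h).
      by case: si => s; [avoid_at (1 : R) (1 : R) | avoid_at (-1 : R) (1 : R)].
  + have [h|h|h] := ltgtP (x (P i)) (x A).
    * have {}si : x (P i) < x C by case: si => // s; case: hr; rewrite s h.
      by avoid_at (-1 : R) (1 : R).
    * have {}si : x C < x (P i) by case: si => // s; case: hl; rewrite s h.
      by avoid_at (1 : R) (1 : R).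
    * have yA := hA i (esym h).
      by case: si => s; [avoid_at (1 : R) (1 : R) | avoid_at (-1 : R) (1 : R)].
Qed.

Lemma std_rev A w B : path_homotopic N [:: A; B] (std A w B) ->
  path_homotopic N [:: B; A] (std B (inv_word w) A).
Proof.
move/path_homotopic_rev.
have -> : std A w B = [:: A; foot A] ++ (O :: std_path w) ++ [:: foot B; B] by [].
by rewrite rev_cat (rev_cat (O :: _)) rev_std_path -catA.
Qed.

Lemma segment_sub A B C : segment A B C -> segment A B `<=` N ->
  segment A C `<=` N /\ segment C B `<=` N /\ triangle_hull A C B `<=` N.
Proof.
move=> hC AB; have h : triangle_hull A C B `<=` N.
  apply: subset_trans AB; apply: hull_sub => //; first exact: convex_segment.
    by rewrite -hull_ABA; exact: hull1.
  by rewrite -hull_ABA; exact: hull2.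
by split; [|split=> //]; apply: (hull_segment h);
  do ?[exact: hull1 | exact: hull2 | exact: hull3].
Qed.

Lemma x_lerp A B (t : R) : x (lerp A B t) = x A + t * (x B - x A).
Proof. by rewrite /lerp /cross !mxE; ring. Qed.

Lemma std_subdivide A B C : segment A B C -> segment A B `<=` N ->
  (exists w, path_homotopic N [:: A; C] (std A w C)) ->
  (exists w, path_homotopic N [:: C; B] (std C w B)) ->
  exists w, path_homotopic N [:: A; B] (std A w B).
Proof.
move=> hC AB [w hw] [u hu]; have [_ [_ h]] := segment_sub hC AB.
exists (w ++ u); apply: PathTrans (path_insert [::] [::] h) _.
by apply: (@std_join A [::] w C u [:: B] B) => //; exact: AB.
Qed.

(** Induction on the number of sites with abscissa strictly between those of [A] and [B]: cutting
    the segment above or below such a site leaves fewer on each half. *)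
Lemma std_segment A B : segment A B `<=` N -> exists w, path_homotopic N [:: A; B] (std A w B).
Proof.
pose btw A B := [set i | (x A < x (P i) < x B) || (x B < x (P i) < x A)]%SET.
move: {2}(#|btw A B|).+1 (ltnSn #|btw A B|) => m; elim: m A B => // m ih A B; rewrite ltnS => hm AB.
have NA : N A by apply: AB; rewrite -hull_ABA; exact: hull1.
have NB : N B by apply: AB; rewrite -hull_ABA; exact: hull2.
have [xAB|xAB] := eqVneq (x A) (x B); first by exists [::]; exact: std_vertical.
have [e0|[k]] := set_0Vmem (btw A B).
  (* With no site strictly between, the midpoint is on the vertical of no site. Each half then fits
     [std_half], the second one after reversal. *)
  have hC : segment A B (lerp A B (1 / 2)) by exists (1 / 2); split=> //; lra.
  have xC := x_lerp A B (1 / 2); move: (lerp A B (1 / 2)) hC xC => C hC xC.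
  have nb i : ~ (x A < x (P i) < x B) /\ ~ (x B < x (P i) < x A).
    have : i \notin btw A B by rewrite e0 finset.in_set0.
    by rewrite finset.in_set negb_or => /andP[/negP h1 /negP h2].
  have [AC [CB h]] := segment_sub hC AB.
  have ltAB : x A < x B \/ x B < x A by move: xAB; rewrite neq_lt => /orP[]; [left|right].
  have gen i : x C != x (P i).
    apply/eqP => xi; have [n1 n2] := nb i; case: ltAB => l; [case: n1 | case: n2]; lra.
  have NC : N C by exact: AB.
  apply: (std_subdivide hC AB).
    apply: std_half => // i; have [n1 n2] := nb i; split=> l; case: ltAB => l';
    do ?[by case: n1; lra | by case: n2; lra | lra].
  have [|w hw] := @std_half B C NB NC gen.
    move=> i; have [n1 n2] := nb i; split=> l; case: ltAB => l';
    do ?[by case: n1; lra | by case: n2; lra | lra].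
  by exists (inv_word w); exact: std_rev.
rewrite finset.in_set => hk.
pose t := (x (P k) - x A) / (x B - x A).
have xBA : x B - x A != 0 by rewrite subr_eq0 eq_sym.
have et : t * (x B - x A) = x (P k) - x A by rewrite divfK.
have ht : 0 <= t <= 1 by move: et; case/orP: hk => hk et; nra.
have hC : segment A B (lerp A B t) by exists t.
have xC : x (lerp A B t) = x (P k) by rewrite x_lerp et; lra.
move: (lerp A B t) hC xC => C hC xC.
have [AC [CB _]] := segment_sub hC AB.
apply: (std_subdivide hC AB); apply: ih => //; apply: leq_trans hm; apply: proper_card;
  apply/properP; split; do ?[by exists k; rewrite finset.in_set ?xC ?ltxx ?andbF];
  apply/fintype.subsetP => i; rewrite !finset.in_set xC;
  by move=> hi; apply/orP; case/orP: hk => hk; case/orP: hi => hi; do ?[by left; lra | by right; lra]; lra.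
Qed.

Lemma std_path_exists A s : s != [::] -> path_in N A s ->
  exists w, path_homotopic N (A :: s) (std A w (last A s)).
Proof.
elim: s A => // B [|C s] ih A _ /= [AB hs].
  by have := std_segment AB.
have [w hw] := std_segment AB; have [u hu] := ih B isT hs.
exists (w ++ u); apply: (@std_join A [::] w B u (C :: s)) => //.
by apply: AB; rewrite -hull_ABA; exact: hull2.
Qed.

Lemma polyline_std s : polyline_in N s ->
  exists w, homotopic_seq N s (rcons (O :: std_path w) O).
Proof.
case: s => [[]//|A s] hA; move/polyline_inE: (hA) => hs.
have [|w] := std_path_exists _ hs; first by case: (s).
rewrite last_rcons => hw; exists w.
have NA : N A.
  move: hs; case: (s) => [|B s'] /= [h _]; apply: h; rewrite -hull_ABA; exact: hull1.
(* Repeating [A] turns the closed line into a path from [A] to [A], to which the normal form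
   applies. The spike joining [A] to [O] is then peeled off cyclically. *)
have c1 : cyc (A :: rcons s A) = cyc (A :: A :: s).
  by rewrite -rcons_cons -cats1 cyc_cat.
have d1 := homotopic_seq_dup hA; have [hAA _] := homotopic_seq_polyline d1.
apply: homotopic_seq_trans (homotopic_seq_sym d1) _.
apply: homotopic_seq_trans (homotopic_seq_cyc hAA (esym c1)) _.
have h1 := homotopic_seq_path hw (polyline_cyc (esym c1) hAA).
apply: homotopic_seq_trans (h1) _.
have [_ h2] := homotopic_seq_polyline h1.
have rot_last B t : cyc (B :: rcons t B) = cyc (B :: B :: t).
  by rewrite -rcons_cons -cats1 cyc_cat.
have stdE : std A w A = A :: rcons (rcons (foot A :: O :: std_path w) (foot A)) A.
  by rewrite /std -!cats1 -!catA.
have c2 : cyc (std A w A) = cyc (A :: A :: rcons (foot A :: O :: std_path w) (foot A)).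
  by rewrite stdE rot_last.
have step s1 s2 t : cyc s1 = cyc s2 -> polyline_in N s1 ->
    (polyline_in N s2 -> homotopic_seq N s2 t) -> homotopic_seq N s1 t /\ polyline_in N t.
  move=> c hs1 /(_ (polyline_cyc c hs1)) h; split.
    by apply: homotopic_seq_trans (homotopic_seq_cyc hs1 c) h.
  by have [] := homotopic_seq_polyline h.
have dup B t s1 : cyc s1 = cyc (B :: B :: t) -> polyline_in N s1 ->
    homotopic_seq N s1 (B :: t) /\ polyline_in N (B :: t).
  move=> c hs1; apply: (step _ _ _ c hs1) => h; apply: homotopic_seq_dup.
  move/polyline_inE: h => /= [_ h]; exact/polyline_inE.
have [h3 p3] := dup _ _ _ c2 h2; apply: homotopic_seq_trans h3 _.
have [|h4 p4] := step _ _ (rcons (foot A :: O :: std_path w) (foot A)) erefl p3.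
  move=> _; apply: homotopic_seq_cancel => //.
  by rewrite /= last_rcons hull_ABA segment_sym; exact: segment_foot.
apply: homotopic_seq_trans h4 _.
have [h5 p5] := dup _ _ _ (rot_last (foot A) (O :: std_path w)) p4; apply: homotopic_seq_trans h5 _.
have [|h6 p6] := step _ _ (O :: std_path w) erefl p5.
  move=> _; apply: homotopic_seq_cancel => //.
  have -> : last O (std_path w) = last O (O :: std_path w) by [].
  by rewrite std_path_rcons last_rcons hull_ABA; apply: segment_below; rewrite ?foot_below.
apply: homotopic_seq_trans h6 _.
have p7 : polyline_in N (O :: O :: std_path w).
  by apply/polyline_inE; split; [exact: segment_below | exact/polyline_inE].
apply: homotopic_seq_trans (homotopic_seq_sym (homotopic_seq_dup p6)) _.
by apply: homotopic_seq_cyc p7 _; rewrite -rot_last.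
Qed.

(** The additional final [O] guarantees a vertex after the initial one even for the empty word, as
    the removal of backtracks requires. *)
Definition std_loop w := rcons (O :: std_path w) O.

Lemma right_top k : segment (right_foot k) (site_top k) `<=` N.
Proof.
have topk : y (P k) < y (site_top k) by rewrite y_top ltrDl.
have h := hull_foot_right (x_top k) topk (x_top k) topk.
by apply: (hull_segment h); [exact: hull2 | exact: hull1].
Qed.

Lemma around_spec a : exists b c t : point,
  [/\ around a = [:: b; t; c], around (inv_letter a) = [:: c; t; b],
      segment b t `<=` N, segment c t `<=` N & y b = y O /\ y c = y O].
Proof.
case: a => i []; do 3 eexists; split; do ?[reflexivity | exact: left_top | exact: right_top];
by rewrite ?coordE.
Qed.

Lemma std_loop_in w : path_in N O (rcons (std_path w) O).
Proof.
elim: w => [|a w ih] /=; first by split=> //; exact: segment_below.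
rewrite /std_path /= -/(std_path w) rcons_cat path_in_cat last_rcons; split=> //.
have [b [c [t [-> _ bt ct [yb yc]]]]] := around_spec a.
by repeat split => //; [exact: segment_below | rewrite segment_sym | exact: segment_below].
Qed.

Lemma std_loop_polyline w : polyline_in N (std_loop w).
Proof.
rewrite /std_loop rcons_cons; apply/polyline_inE; rewrite -cats1 path_in_cat last_rcons /=.
by split; [exact: std_loop_in | split=> //; exact: segment_below].
Qed.

Lemma std_loop_cat u w : std_loop (u ++ w) = std_path_from u ++ std_loop w.
Proof. by rewrite /std_loop std_path_cat -cat_cons std_path_rcons cat_rcons rcons_cat. Qed.

Lemma std_loop_head w : exists X q, std_loop w = [:: O, X & q] /\ y X = y O.
Proof.
rewrite /std_loop; case: w => [|a w]; first by exists O, [::].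
have [b [c [t [e1 _ _ _ [yb _]]]]] := around_spec a.
by rewrite /std_path /= e1 /=; do 2 eexists; split; [reflexivity|].
Qed.

Lemma std_loop_cancel a w :
  path_homotopic N (std_loop (a :: inv_letter a :: w)) (std_loop w).
Proof.
rewrite -[a :: _]/([:: a; inv_letter a] ++ w) std_loop_cat /std_path_from /=.
have [b [c [t [-> -> bt ct [yb yc]]]]] := around_spec a.
have [X [q [-> hX]]] := std_loop_head w; rewrite /=.
have tc : segment t c `<=` N by rewrite segment_sym.
have tb : segment t b `<=` N by rewrite segment_sym.
have low A B : y A = y O -> y B = y O -> segment A B `<=` N by exact: segment_below.
(* The path goes around and straight back; the spike is shortened from its tip, removing [O], [c],
   [t] and [b] in turn. *)
apply: PathTrans (@path_backtrack _ N [:: O; b; t] c O [:: b, O, X & q] t _ _) _ => //; first exact: low.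
apply: PathTrans (@path_backtrack _ N [:: O; b] t c [:: O, X & q] b _ _) _ => //.
apply: PathTrans (@path_backtrack _ N [:: O] b t [:: X & q] O _ _) _ => //; first exact: low.
by apply: (@path_backtrack _ N [::] O b q X); exact: low.
Qed.

Lemma std_loop_red w : path_homotopic N (std_loop w) (std_loop (red w)).
Proof.
elim: w => [|a w ih] /=; first exact: PathRefl.
have cons a' w' : std_loop (a' :: w') = std_path_from [:: a'] ++ std_loop w'.
  exact: (std_loop_cat [:: a']).
apply: (@PathTrans _ _ (std_loop (a :: red w))); first by rewrite !cons; exact: path_homotopic_catl.
case: (red w) => [|b r] /=; first exact: PathRefl.
by case: eqP => [->|_]; [exact: std_loop_cancel | exact: PathRefl].
Qed.

Lemma std_loop_rot u w : homotopic_seq N (std_loop (u ++ w)) (std_loop (w ++ u)).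
Proof.
case: u => [|a u]; first by rewrite cats0; apply: homotopic_seq_cyc => //; exact: std_loop_polyline.
have loopE z : std_loop z = std_path_from z ++ [:: O; O].
  by rewrite /std_loop std_path_rcons -!cats1 -catA.
have [b [c [t [e1 _ _ _ [yb _]]]]] := around_spec a.
have low A B : y A = y O -> y B = y O -> segment A B `<=` N by exact: segment_below.
set v := a :: u; have [m vE] : exists m, std_path_from v = [:: O, b & m].
  by rewrite /v /std_path_from /= e1; eexists.
have c1 : cyc (std_loop (v ++ w)) = cyc (std_path_from w ++ [:: O; O] ++ std_path_from v).
  by rewrite std_loop_cat loopE cyc_cat -catA.
have p1 := polyline_cyc c1 (std_loop_polyline (v ++ w)).
apply: homotopic_seq_trans (homotopic_seq_cyc (std_loop_polyline _) c1) _.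
have h2 : homotopic_seq N (std_path_from w ++ [:: O; O] ++ std_path_from v)
    (std_path_from w ++ std_path_from v).
  apply: homotopic_seq_path p1; rewrite vE.
  by apply: path_backtrack; exact: low.
apply: homotopic_seq_trans (h2) _.
have e3 : std_loop (w ++ v) = (std_path_from w ++ std_path_from v) ++ [:: O; O].
  by rewrite std_loop_cat loopE catA.
have [m' fE] : exists m', std_path_from w ++ std_path_from v = O :: m'.
  by rewrite vE; case: (w) => [|a' w']; eexists; reflexivity.
have [_] := homotopic_seq_polyline h2; rewrite e3 fE => p2.
have p3 : polyline_in N [:: O, O & m'].
  by apply/polyline_inE; split; [exact: low | exact/polyline_inE].
have p4 : polyline_in N [:: O, O, O & m'].
  by apply/polyline_inE; split; [exact: low | exact/polyline_inE].
apply: homotopic_seq_trans (homotopic_seq_sym (homotopic_seq_dup p2)) _.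
apply: homotopic_seq_trans (homotopic_seq_sym (homotopic_seq_dup p3)) _.
by apply: homotopic_seq_cyc p4 _; rewrite -[[:: O, O, O & m']]/([:: O; O] ++ O :: m') cyc_cat.
Qed.

Lemma std_loop_conj u w : conj_words u w -> homotopic_seq N (std_loop u) (std_loop w).
Proof.
have weq z z' : red z = red z' -> homotopic_seq N (std_loop z) (std_loop z').
  move=> h; apply: homotopic_seq_path (std_loop_polyline _).
  by apply: PathTrans (std_loop_red _) _; rewrite h; apply: PathSym; exact: std_loop_red.
move=> [h /weq h1]; apply: homotopic_seq_trans h1; apply: homotopic_seq_sym.
apply: homotopic_seq_trans (std_loop_rot _ _) _; apply: weq; rewrite -catA -[in RHS](cats0 u).
by apply: red_cat => //; rewrite -(red_Vmul h [::]) cats0.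
Qed.

Lemma foot_base : foot O = O.
Proof.
have NO : N O by move=> [i _ eO]; have := O_below i; rewrite eO ltxx.
case: (footP NO) => [i _ yi|_]; first by have := O_below i; rewrite ltNge (ltW yi).
by apply: xy_inj; rewrite ?x_pt ?y_pt.
Qed.

Section Words.
Variable v : 'I_n -> point.
Hypothesis v_neq0 : forall i, v i != 0.
Hypothesis ray_disjoint : forall i j X, i != j -> ray P v i X -> ~ ray P v j X.
Local Notation path_word := (path_word P v).

Definition generator_word i := path_word (O :: rcons (around (i, true)) O).

Lemma path_word_around a : path_word (O :: rcons (around a) O) =
  if a.2 then generator_word a.1 else inv_word (generator_word a.1).
Proof.
case: a => i [] //=; rewrite /generator_word.
have low A B : y A = y O -> y B = y O -> segment A B `<=` N by exact: segment_below.
rewrite -(path_word_rev v_neq0 ray_disjoint) //.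
by repeat split; [apply: low; rewrite ?coordE | exact: left_top
  | rewrite segment_sym; exact: right_top | apply: low; rewrite ?coordE].
Qed.

Lemma path_word_std_path w : path_word (O :: std_path w) = subst_word generator_word w.
Proof.
elim: w => // a w ih.
rewrite -[std_path (a :: w)]/(rcons (around a) O ++ std_path w) cat_rcons -cat_cons path_word_cat rcons_cons path_word_around.
by rewrite ih.
Qed.

Lemma closed_word_std_loop w : closed_word P v (std_loop w) = subst_word generator_word w.
Proof.
rewrite /std_loop rcons_cons closed_word_cons -rcons_cons path_word_rcons last_rcons.
by rewrite cut_word_refl cats0 -rcons_cons path_word_rcons std_path_last cut_word_refl cats0 path_word_std_path.
Qed.

Lemma loop_word s : s != [::] -> path_in N O s -> last O s = O ->
  exists w, red (path_word (O :: s)) = red (subst_word generator_word w).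
Proof.
move=> s0 hs ls; have [w] := std_path_exists s0 hs; rewrite ls => h; exists w.
rewrite (path_word_homotopic v_neq0 ray_disjoint h) /std foot_base.
have -> : (O :: std_path w) ++ [:: O; O] = rcons (rcons (O :: std_path w) O) O.
  by rewrite -!cats1 -!catA.
rewrite 2!rcons_cons 2!path_word_cons cut_word_refl -2!rcons_cons.
by rewrite rcons_cons path_word_rcons last_rcons -rcons_cons path_word_rcons std_path_last
  cut_word_refl !cats0 path_word_std_path.
Qed.

End Words.
End Generation.

(** * Paths avoiding the rays *)

Section Detours.
Context {R : realType} {n : nat}.
Local Notation point := 'rV[R]_2.
Variables (P v : 'I_n -> point).
Implicit Types (A B C X Y Z : point) (K : set point) (i j : 'I_n) (s t p q : seq point).
Hypothesis v_neq0 : forall i, v i != 0.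
Hypothesis ray_disjoint : forall i j X, i != j -> ray P v i X -> ~ ray P v j X.
Local Notation N := (~` range P).
Local Notation ray := (ray P v).
Local Notation dev := (dev P v).
Local Notation cuts := (cuts P v).
Local Notation cut_word := (cut_word P v).
Local Notation path_word := (path_word P v).

Definition off_rays : set point := [set X | forall i, ~ ray i X].

Lemma off_rays_sites : off_rays `<=` N.
Proof. by move=> X h [i _ e]; apply: (h i); rewrite -e; exact: ray_origin. Qed.

Lemma cut_word_off_rays A B : segment A B `<=` off_rays -> cut_word A B = [::].
Proof.
move=> h; rewrite /cut_word (eq_filter (a2 := pred0)) ?filter_pred0 // => i.
apply/negP => /andP[hs /asboolP]; have [ht _] := cut_timeP hs.
by apply: h; exists (cut_time P v A B i).
Qed.

Lemma path_word_off_rays A s : path_in off_rays A s -> path_word (A :: s) = [::].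
Proof.
by elim: s A => //= B s ih A [AB /ih hs]; rewrite cut_word_off_rays.
Qed.

Lemma path_in_sub K K' A s : K `<=` K' -> path_in K A s -> path_in K' A s.
Proof. by move=> KK'; elim: s A => //= B s ih A [h /ih]; split=> //; exact: subset_trans KK'. Qed.

(** The gap is uniform along the whole rays, which yields strips of constant width. For independent
    directions one of the two carrying lines separates; for parallel lines their common direction
    gives the form; on one line the rays must point away from each other. *)
Lemma ray_separate i j : i != j -> exists u (a b : R), [/\ a < b,
  forall X, ray i X -> b <= cross u X & forall X, ray j X -> cross u X <= a].
Proof.
move=> ij; pose w := P i - P j; pose c := cross (v j) (v i).
have disj (t t' : R) : 0 <= t -> 0 <= t' -> P i + t *: v i <> P j + t' *: v j.
  by move=> t0 t'0 h; apply: (ray_disjoint ij (X := P i + t *: v i)); [exists t | exists t'].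
have crossZl (z X : point) (a : R) : cross (a *: z) X = a * cross z X by rewrite /cross !mxE; ring.
have crossvv (z : point) : cross z z = 0 by rewrite /cross; ring.
have Pij u : cross u (P i) = cross u (P j) + cross u w.
  by rewrite /w /cross !mxE; ring.
have cji : cross (v i) (v j) = - c by rewrite /c /cross; ring.
have [c0|c0] := eqVneq c 0; last first.
  have c2 : 0 < c * c by rewrite -expr2 exprn_even_gt0.
  (* Cramer's rule: the carrying lines meet at parameter [s] on the first and [t] on the second.
     Disjointness of the rays forces one of them to be negative. *)
  pose s := - cross (v j) w / c; pose t := - cross (v i) w / c.
  have es : cross (v j) w = - s * c by rewrite /s mulNr divfK // opprK.
  have et : cross (v i) w = - t * c by rewrite /t mulNr divfK // opprK.
  have [s0|s0] := ltP s 0.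
    exists (c *: v j), (cross (c *: v j) (P j)), (cross (c *: v j) (P j) + c * (- s * c)); split.
    - by rewrite ltrDl; nra.
    - move=> X [r [r0 ->]]; have rc := mulr_ge0 r0 (ltW c2); rewrite crossD crossZ Pij !crossZl es -/c; lra.
    - move=> X [r [r0 ->]]; rewrite crossD crossZ !crossZl crossvv; nra.
  have [t0|t0] := ltP t 0.
    exists (c *: v i), (cross (c *: v i) (P j)), (cross (c *: v i) (P j) + c * (- t * c)); split.
    - by rewrite ltrDl; nra.
    - move=> X [r [r0 ->]]; rewrite crossD crossZ Pij !crossZl et crossvv; nra.
    - move=> X [r [r0 ->]]; have rc := mulr_ge0 r0 (ltW c2); rewrite crossD crossZ !crossZl cji; lra.
  case: (disj s t s0 t0); move: s t es et {s0 t0} => s t es et.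
  have comb k : c * (P i 0 k + s * v i 0 k) - c * (P j 0 k + t * v j 0 k) =
      c * (P i 0 k - P j 0 k) - v i 0 k * cross (v j) w + v j 0 k * cross (v i) w.
    by rewrite es et; ring.
  by apply: point_eq; rewrite !mxE; apply: (mulfI c0); apply/eqP; rewrite -subr_eq0 comb;
    apply/eqP; rewrite /c /w /cross !mxE; ring.
have [w0|w0] := eqVneq (cross (v i) w) 0; last first.
  have w2 : 0 < cross (v i) w * cross (v i) w by rewrite -expr2 exprn_even_gt0.
  set k := cross (v i) w in w2 *.
  exists (k *: v i), (cross (k *: v i) (P j)), (cross (k *: v i) (P i)); split.
  - by rewrite Pij !crossZl -/k; lra.
  - by move=> X [r [r0 ->]]; rewrite crossD crossZ !crossZl crossvv; lra.
  - by move=> X [r [r0 ->]]; rewrite crossD crossZ !crossZl cji c0; lra.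
have [l el] : exists l, v j = l *: v i by apply: cross_parallel => //; rewrite cji c0 oppr0.
have [m em] := cross_parallel (v_neq0 i) w0.
have l0 : l != 0 by apply: contraTneq (v_neq0 j) => l0; rewrite el l0 scale0r eqxx.
have hPj : P j = P i - m *: v i by rewrite -em /w subKr.
have [lpos|lneg] := ltP 0 l.
  (* Rays of the same direction on one line overlap: the point at parameter [|m|] of ray [i] is
     beyond both origins. *)
  pose r := `|m| : R.
  have r1 : 0 <= r + m by rewrite /r; have := ler_norm (- m); rewrite normrN; lra.
  case: (disj r ((r + m) / l)); rewrite ?normr_ge0 ?divr_ge0 // ?ltW // el hPj.
  by rewrite scalerA divfK // scalerDl; apply: point_eq; rewrite !mxE; ring.
have lneg' : l < 0 by rewrite lt_neqAle l0.
have m0 : 0 < m.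
  rewrite ltNge; apply/negP => m0; case: (disj 0 (m / l)) => //.
    by rewrite mulr_le0 // invr_le0 ltW.
  by rewrite el hPj scalerA divfK // scale0r addr0 subrK.
exists (- quarter_turn (v i)).
have key X : cross (- quarter_turn (v i)) X = v i 0 0 * X 0 0 + v i 0 1 * X 0 1.
  by rewrite /cross !mxE /=; ring.
have v2 := sqr_norm_gt0 (v_neq0 i); set V := _ + _ in v2.
exists (cross (- quarter_turn (v i)) (P i) - m * V), (cross (- quarter_turn (v i)) (P i)).
have kv : cross (- quarter_turn (v i)) (v i) = V by rewrite key.
split.
- by rewrite gtrDl oppr_lt0; nra.
- by move=> X [r [r0 ->]]; rewrite crossD crossZ kv; nra.
- move=> X [r [r0 ->]]; have rl : r * (l * V) <= 0 by rewrite mulr_ge0_le0 // nmulr_rle0 // ltW.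
  by rewrite el hPj -scaleNr !crossD !crossZ kv; lra.
Qed.

Lemma for_small_strip i (zs : seq point) : for_small (fun s : R => forall Y Y' Z Z' X j,
  ray i Y -> ray i Y' -> Z \in zs -> Z' \in zs -> i != j ->
  segment (Y + s *: Z) (Y' + s *: Z') X -> ~ ray j X).
Proof.
have h j : for_small (fun s : R => i != j -> forall Y Y' Z Z' X,
    ray i Y -> ray i Y' -> Z \in zs -> Z' \in zs ->
    segment (Y + s *: Z) (Y' + s *: Z') X -> ~ ray j X).
  have [->|ij] := eqVneq i j; first by exists 1.
  have [u [a [b [ab hi hj]]]] := ray_separate ij.
  have := @for_small_all _ _ zs (fun Z (s : R) => - b + s * cross u (- Z) < - a).
  case=> [Z _|]; first by apply: for_small_lt; lra.
  move=> e [e0 he]; exists e; split=> // s hs _ Y Y' Z Z' X iY iY' zZ zZ' [t [ht ->]] /hj.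
  have := he s hs Z zZ; have := he s hs Z' zZ'; have := hi _ iY; have := hi _ iY'.
  have crossN X' : cross u (- X') = - cross u X' by rewrite /cross !mxE; ring.
  rewrite !crossN !(crossD, crossZ, crossN).
  move: (cross u Y) (cross u Y') (cross u Z) (cross u Z') => y y' z z' h1 h2 h3 h4 h5.
  move/andP: ht => [t0 t1]; have p0 : 0 < y + s * z - a by lra.
  have q0 : 0 < y' + s * z' - a by lra.
  have q1 : 0 <= t * (y' + s * z' - a) by rewrite mulr_ge0 // ltW.
  have [t2|t3] := ltP t 1; last first.
    have te : t = 1 by lra.
    by rewrite te in h5; lra.
  have p2 : 0 < (1 - t) * (y + s * z - a) by apply: mulr_gt0; lra.
  by lra.
apply: for_small_sub (for_small_forall h) => s _ hs Y Y' Z Z' X j iY iY' hZ hZ' ij.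
exact: hs.
Qed.

Lemma dev_shift i X Z (s : R) : dev i (X + s *: Z) = dev i X + s * cross (v i) Z.
Proof. by rewrite /dev /cross !mxE; ring. Qed.

Lemma segment_left A B : segment A B A.
Proof. by exists 0; rewrite lexx ler01 scale0r addr0. Qed.

Lemma segment_right A B : segment A B B.
Proof. by exists 1; rewrite lexx ler01 scale1r addrC subrK. Qed.

Definition linked A B := exists s, path_in off_rays A s /\ last A s = B.

Lemma linked_trans B A C : linked A B -> linked B C -> linked A C.
Proof.
move=> [s [hs <-]] [t [ht <-]]; exists (s ++ t); rewrite last_cat; split=> //.
exact/path_in_cat.
Qed.

Lemma linked_segment A B : segment A B `<=` off_rays -> linked A B.
Proof. by move=> h; exists [:: B]. Qed.

(* A crossing of the ray [i] at [Y] is avoided by following the ray back to *)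
(* its origin.                                                              *)
Lemma linked_around i Y Z : ray i Y -> cross (v i) Z != 0 ->
  for_small (fun s : R => linked (Y - s *: Z) (Y + s *: Z) /\
    off_rays (Y - s *: Z) /\ off_rays (Y + s *: Z)).
Proof.
move=> iY vZ; apply: for_small_sub (for_small_strip i [:: Z; - Z; - v i]) => s s0 strip.
(* A point just behind the origin of the ray. The detour goes from one side to [Q] and back along
   the other side, meeting the carrying line only at [Q]. *)
pose Q := P i + s *: - v i.
have Qi : ~ ray i Q.
  move=> [t [t0]]; rewrite /Q => /addrI/eqP; rewrite scalerN -scaleNr -subr_eq0 -scalerBl scaler_eq0.
  by rewrite (negPf (v_neq0 i)) orbF => /eqP h; lra.
have devQ : dev i Q = 0 by rewrite dev_shift (dev_ray (ray_origin P v i)) /cross !mxE; ring.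
have off W : W \in [:: Z; - Z] -> segment (Y + s *: W) Q `<=` off_rays.
  move=> hW X hX j; have [<-|ij] := eqVneq i j; last first.
    apply: (strip Y (P i) W (- v i)) => //; last by rewrite !inE eqxx !orbT.
      exact: ray_origin.
    by move: hW; rewrite !inE => /orP[] ->; rewrite ?orbT.
  move: hX => [t [ht ->]] h; have := dev_ray h.
  rewrite -/(lerp _ _ t) dev_lerp devQ dev_shift (dev_ray iY) mulr0 addr0 add0r => /eqP.
  have vW : cross (v i) W != 0.
    move: hW; rewrite !inE => /orP[] /eqP-> //.
    by rewrite (_ : cross (v i) (- Z) = - cross (v i) Z) ?oppr_eq0 // /cross !mxE; ring.
  rewrite !mulf_eq0 (negPf vW) orbF (gt_eqF s0) orbF subr_eq0 => /eqP t1.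
  by apply: Qi; move: h; rewrite -t1 scale1r addrC subrK.
have oZ := off Z; have oN := off (- Z).
rewrite !inE !eqxx !orbT scalerN in oZ oN.
split; last by split; [exact: (oN isT _ (segment_left _ _)) | exact: (oZ isT _ (segment_left _ _))].
apply: (@linked_trans Q); apply: linked_segment; first exact: oN.
by rewrite segment_sym; exact: oZ.
Qed.

(** Induction on the number of rays cut. One crossing is replaced by the detour of [linked_around];
    the two remaining pieces of [AB] cut no new ray and no longer cut [i]. *)
Lemma linked_in_sites A B : off_rays A -> off_rays B -> segment A B `<=` N -> linked A B.
Proof.
move: {2}(#|[set i | cuts A B i]%SET|).+1 (ltnSn #|[set i | cuts A B i]%SET|) => m.
elim: m A B => // m ih A B; rewrite ltnS => hm rA rB AB.
have [[i [Y [kY iY]]]|none] := pselect (exists i Y, segment A B Y /\ ray i Y); last first.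
  by apply: linked_segment => X hX i iX; apply: none; exists i, X.
have sides := crossed_ray_sides v_neq0 AB (rA i) (rB i) kY iY.
have devBA : cross (v i) (B - A) = dev i B - dev i A by rewrite /dev /cross !mxE; ring.
have hZ : cross (v i) (B - A) != 0 by rewrite devBA; apply/eqP => h; case: sides => -[]; lra.
move: (kY) => [t [ht eY]].
have dY := dev_ray iY; have := dY; rewrite eY -/(lerp A B t) dev_lerp => e0.
have t0 : 0 < t by rewrite lt_neqAle; apply/andP; split; [apply/eqP => h; case: sides => -[]; nra | lra].
have t1 : t < 1 by rewrite lt_neqAle; apply/andP; split; [apply/eqP => h; case: sides => -[]; nra | lra].
have tt : - t < 0 by lra.
(* The two inequalities [t + s < 1] and [s < t] keep both ends of the detour on the segment [AB]. *)
have := for_small_and (linked_around iY hZ) (for_small_and (for_small_lt 1 t1) (for_small_lt 1 tt)).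
move=> /for_small_ex[s [s0 [[link [r1 r2]] [s1 s2]]]].
have kX : segment A B (Y - s *: (B - A)).
  by exists (t - s); split; [lra | rewrite eY -addrA -scaleNr -scalerDl].
have kX' : segment A B (Y + s *: (B - A)).
  by exists (t + s); split; [lra | rewrite eY -addrA -scalerDl].
have dX : dev i (Y - s *: (B - A)) = - (s * (dev i B - dev i A)).
  by rewrite -scaleNr dev_shift dY devBA; ring.
have dX' : dev i (Y + s *: (B - A)) = s * (dev i B - dev i A).
  by rewrite dev_shift dY devBA; ring.
move: (Y - s *: (B - A)) (Y + s *: (B - A)) link r1 r2 kX kX' dX dX' => X X' link r1 r2 kX kX' dX dX'.
have [AX [_ _]] := segment_sub kX AB; have [_ [XB _]] := segment_sub kX' AB.
have Kc := @convex_segment R A B; have Ka j := @avoids_sites _ _ P _ j AB.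
have ai : active P v (segment A B) i by apply/asboolP; exists Y.
have kA := segment_left A B; have kB := segment_right A B.
have cE C D j : segment A B C -> segment A B D
  -> cuts C D j = active P v (segment A B) j && (side P v j C != side P v j D).
  by move=> kC kD; rewrite (cutsE v_neq0 Kc Ka).
have sideE j C : segment A B C -> side P v j A = side P v j B -> side P v j C = side P v j A.
  by move=> [t' [ht' ->]] h; exact: side_lerp.
apply: (linked_trans (B := X)).
  apply: ih => //; apply: leq_trans hm; apply: proper_card; apply/properP; split.
    apply/fintype.subsetP => j; rewrite !finset.in_set !cE // => /andP[-> /=]; apply: contra => /eqP h.
    by rewrite (sideE j X).
  exists i; rewrite finset.in_set cE // ai /=.
    by rewrite /side; case: sides => -[h1 h2]; [rewrite h1 (lt_gtF h2) | rewrite h2 (lt_gtF h1)].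
  rewrite negbK /side dX; case: sides => -[h1 h2].
    by rewrite h1 oppr_lt0 mulr_gt0 // subr_gt0 (lt_trans h1).
  by rewrite (lt_gtF h1) oppr_lt0 pmulr_rgt0 // subr_gt0 (lt_gtF (lt_trans h2 h1)).
apply: (linked_trans link).
apply: ih => //; apply: leq_trans hm; apply: proper_card; apply/properP; split.
  apply/fintype.subsetP => j; rewrite !finset.in_set !cE // => /andP[-> /=]; apply: contra => /eqP h.
  by rewrite (sideE j X') // h.
exists i; rewrite finset.in_set cE // ai /=.
  by rewrite /side; case: sides => -[h1 h2]; [rewrite h1 (lt_gtF h2) | rewrite h2 (lt_gtF h1)].
rewrite negbK /side dX'; case: sides => -[h1 h2].
  by rewrite (lt_gtF h2) pmulr_rlt0 // subr_lt0 (lt_gtF (lt_trans h1 h2)).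
by rewrite h2 pmulr_rlt0 // subr_lt0 (lt_trans h2).
Qed.

(** The segment [AB] may contain sites, so it is replaced by two segments through a point [C] near
    [A]. Transversality of [d] to the rays keeps [C] off them; transversality to the directions from
    [A] and [B] to the sites keeps the two segments in [N]. *)
Lemma linked_off_rays A B : off_rays A -> off_rays B -> linked A B.
Proof.
move=> rA rB.
pose l := [seq v i | i <- enum 'I_n] ++ [seq P i - A | i <- enum 'I_n] ++ [seq P i - B | i <- enum 'I_n].
have site_neq C i : off_rays C -> P i - C != 0.
  by move=> rC; rewrite subr_eq0; apply/eqP => e; apply: (rC i); rewrite -e; exact: ray_origin.
have [|d hd] := @exists_transversal _ l.
  by move=> u; rewrite !mem_cat => /or3P[] /mapP[i _ ->] //; exact: site_neq.
have hv i : cross (v i) d != 0 by apply: hd; rewrite mem_cat map_f ?mem_enum.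
have hA i : cross (P i - A) d != 0.
  by apply: hd; rewrite !mem_cat (map_f (fun i => P i - A)) ?mem_enum ?orbT.
have hB i : cross (P i - B) d != 0.
  by apply: hd; rewrite !mem_cat (map_f (fun i => P i - B)) ?mem_enum ?orbT.
have := for_small_and (for_small_off_rays P A hv)
  (for_small_forall (fun i => for_small_neq0 (cross (P i - B) (A - B)) (hB i))).
move=> /for_small_ex[s [s0 [rC hC]]]; set C := A + s *: d in rC *.
have miss D D' : (forall i, cross (P i - D) (D' - D) != 0) -> segment D D' `<=` N.
  move=> h; apply: subset_sites => i [t [_ e]]; case/negP: (h i); apply/eqP.
  by rewrite e (addrC D) addrK /cross !mxE; ring.
apply: (linked_trans (B := C)); apply: linked_in_sites => //.
  apply: miss => i; rewrite /C (addrC A) addrK crossZ mulf_neq0 // gt_eqF //.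
rewrite segment_sym; apply: miss => i.
by rewrite /C -addrA addrCA addrC crossD crossZ.
Qed.

Lemma exists_simple_loop O i : off_rays O -> exists s,
  [/\ path_in N O s, last O s = O, s != [::] & path_word (O :: s) = [:: (i, true)]].
Proof.
(* With this sign [cross (v i) Z] is negative, so moving along [Z] ends on the side [dev i < 0] and
   contributes [(i, true)], not its inverse. *)
move=> rO; pose Z := - quarter_turn (v i).
have hZ : cross (v i) Z < 0.
  by have := sqr_norm_gt0 (v_neq0 i); rewrite /Z /cross !mxE /=; lra.
pose Y := P i + 1 *: v i; have iY : ray i Y by exists 1.
have iPY : P i <> Y by rewrite /Y scale1r => /eqP;
  rewrite -subr_eq0 opprD addNKr oppr_eq0 (negPf (v_neq0 i)).
have := for_small_and (for_small_strip i [:: Z; - Z]) (linked_around iY (ltr0_neq0 hZ)).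
move=> /for_small_ex[s [s0 [strip [_ [rX rX']]]]].
have dX : dev i (Y - s *: Z) = - (s * cross (v i) Z).
  by rewrite -scaleNr dev_shift (dev_ray iY); ring.
have dX' : dev i (Y + s *: Z) = s * cross (v i) Z.
  by rewrite dev_shift (dev_ray iY); ring.
have miss j W : i != j -> segment (Y - s *: Z) (Y + s *: Z) W -> ~ ray j W.
  by move=> ij; rewrite -scalerN => hW; apply: (strip Y Y (- Z) Z) hW; rewrite ?inE ?eqxx ?orbT.
have XX' : segment (Y - s *: Z) (Y + s *: Z) `<=` N.
  apply: subset_sites => j; have [<-|ij] := eqVneq i j; last first.
    by move=> /(miss _ _ ij); apply; exact: ray_origin.
  move=> [t [ht e]]; have := dev_ray (ray_origin P v i); rewrite {1}e -/(lerp _ _ t) dev_lerp dX dX' => h.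
  have {}h : (2 * t - 1) * (s * cross (v i) Z) = 0 by rewrite -[RHS]h; ring.
  move/eqP: h; rewrite !mulf_eq0 (gt_eqF s0) (lt_eqF hZ) !orbF => /eqP h.
  have t2 : t = 1 / 2 by lra.
  by apply: iPY; rewrite e t2; apply: point_eq; rewrite !mxE; field.
have kY : segment (Y - s *: Z) (Y + s *: Z) Y.
  by exists (1 / 2); split; [lra | apply: point_eq; rewrite !mxE; field].
have word : cut_word (Y - s *: Z) (Y + s *: Z) = [:: (i, true)].
  have sX' : side P v i (Y + s *: Z) by rewrite /side dX' pmulr_rlt0.
  have sX : side P v i (Y - s *: Z) = false.
    by rewrite /side dX oppr_lt0 pmulr_rgt0 // (lt_gtF hZ).
  have Kc := @convex_segment R (Y - s *: Z) (Y + s *: Z).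
  have Ka j := @avoids_sites _ _ P _ j XX'.
  rewrite /cut_word (eq_filter (a2 := pred1 i)) ?filter_pred1_uniq ?enum_uniq ?mem_enum //=.
    by rewrite sX'.
  move=> j; rewrite (cutsE v_neq0 Kc Ka); [|exact: segment_left|exact: segment_right].
  rewrite /= eq_sym; have [<-|ij] := eqVneq i j.
    by rewrite sX sX' andbT; apply/asboolP; exists Y.
  by apply/negP => /andP[/asboolP[X [kX /(miss _ _ ij kX)]]].
have [p [hp lp]] := linked_off_rays rO rX; have [q [hq lq]] := linked_off_rays rX' rO.
have ON := off_rays_sites.
exists (p ++ (Y + s *: Z) :: q); split.
- by apply/path_in_cat; rewrite lp; split; [exact: path_in_sub hp | split=> //; exact: path_in_sub hq].
- by rewrite last_cat.
- by case: (p).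
case/lastP: p lp hp => [lp hp|p X]; first by rewrite /= in lp;
  rewrite lp cat0s path_word_cons word path_word_off_rays.
rewrite last_rcons => -> hp; rewrite cat_rcons -cat_cons path_word_cat path_word_cons word.
by rewrite (path_word_off_rays hq) rcons_cons path_word_off_rays.
Qed.

End Detours.

(** * Linear coordinates adapted to the sites *)

Section Coordinates.
Context {R : realType} {n : nat}.
Local Notation point := 'rV[R]_2.
Implicit Types (X Y : point) (i j : 'I_n).

Lemma exists_coordinates (P : 'I_n -> point) : injective P ->
  exists (f g : point) (pt : R -> R -> point),
    [/\ forall a b, cross f (pt a b) = a, forall a b, cross g (pt a b) = b,
        forall X Y, cross f X = cross f Y -> cross g X = cross g Y -> X = Y
      & forall i j, i != j -> cross f (P i) != cross f (P j)].
Proof.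
move=> P_inj.
(* The extra vector forces [d] to be nonzero even if there is a single site and hence no difference
   in the list. *)
pose l := mkpt 1 0 :: [seq P e.1 - P e.2 | e <- enum {: 'I_n * 'I_n} & e.1 != e.2].
have [|d hd] := @exists_transversal _ l.
  move=> u; rewrite inE => /orP[/eqP->|/mapP[[i j]]].
    apply/eqP => /(congr1 (fun X : point => X 0 0)); rewrite mkpt0 mxE => /eqP.
    by rewrite oner_eq0.
  by rewrite mem_filter => /andP[ij _] ->; rewrite subr_eq0 (inj_eq P_inj).
have d0 : d != 0.
  apply/eqP => d0; have := hd _ (mem_head _ _); rewrite d0 /cross !mxE.
  by rewrite !mulr0 subrr eqxx.
have q0 := sqr_norm_gt0 d0; have q1 := lt0r_neq0 q0.
exists d, (quarter_turn d), (fun a b =>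
  (a / (d 0 0 * d 0 0 + d 0 1 * d 0 1)) *: quarter_turn d - (b / (d 0 0 * d 0 0 + d 0 1 * d 0 1)) *: d).
split.
- by move=> a b; rewrite /cross !mxE /=; field.
- by move=> a b; rewrite /cross !mxE /=; field.
- move=> X Y; rewrite !cross_quarter_turn /cross => h1 h2.
  set a1 := d 0 0 * X 0 0 + d 0 1 * X 0 1 - (d 0 0 * Y 0 0 + d 0 1 * Y 0 1).
  set a2 := d 0 0 * X 0 1 - d 0 1 * X 0 0 - (d 0 0 * Y 0 1 - d 0 1 * Y 0 0).
  have a10 : a1 = 0 by rewrite /a1; lra.
  have a20 : a2 = 0 by rewrite /a2; lra.
  have comb k p q : (d 0 0 * d 0 0 + d 0 1 * d 0 1) * (X 0 k - Y 0 k) = p * a1 + q * a2 ->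
      X 0 k = Y 0 k.
    by rewrite a10 a20 !mulr0 addr0 => /eqP; rewrite mulf_eq0 (negPf q1) subr_eq0 => /eqP.
  apply: point_eq.
    by apply: (comb _ (d 0 0) (- d 0 1)); rewrite /a1 /a2; ring.
  by apply: (comb _ (d 0 1) (d 0 0)); rewrite /a1 /a2; ring.
move=> i j ij; have : P i - P j \in l.
  by rewrite inE; apply/orP; right; apply/mapP; exists (i, j); rewrite // mem_filter ij mem_enum.
move/hd; apply: contra => /eqP h; apply/eqP.
by move: h; rewrite /cross !mxE; lra.
Qed.

End Coordinates.

(** * The classification *)

Section Classification.
Context {R : realType} {n : nat}.
Local Notation point := 'rV[R]_2.
Variables (P v : 'I_n -> point).
Implicit Types (X Y : point) (i j : 'I_n) (s t : seq point) (w u : seq (letter n)).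
Hypothesis P_inj : injective P.
Hypothesis v_neq0 : forall i, v i != 0.
Hypothesis ray_disjoint : forall i j X, i != j -> ray P v i X -> ~ ray P v j X.
Local Notation N := (~` range P).

Lemma exists_generators : exists (phi : 'I_n -> seq (letter n)) (L : seq (letter n) -> seq point),
  [/\ forall w, polyline_in N (L w),
      forall w, closed_word P v (L w) = subst_word phi w,
      forall s, polyline_in N s -> exists w, homotopic_seq N s (L w),
      forall u w, conj_words u w -> homotopic_seq N (L u) (L w)
    & forall i, exists w, red (subst_word phi w) = [:: (i, true)]].
Proof.
have [f [g [pt [x_pt y_pt xy_inj x_sites]]]] := exists_coordinates P_inj.
(* The base point must also be off the rays, for the loops crossing a single ray; a small
   perturbation of a low point keeps it below the sites. *)
have [O [rO O_below]] : exists O, off_rays P v O /\ forall i, cross g O < cross g (P i).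
  have [d hd] := exists_ray_transversal v_neq0.
  have [a ha] := exists_gt [seq - cross g (P i) | i <- enum 'I_n].
  have lowX i : cross g (pt 0 (- a)) < cross g (P i).
    by rewrite y_pt ltrNl; apply: ha; rewrite (map_f (fun i => - cross g (P i))) ?mem_enum.
  have := for_small_and (for_small_off_rays P (pt 0 (- a)) hd)
    (for_small_forall (fun i => for_small_lt (cross g d) (lowX i))).
  move=> /for_small_ex[s [_ [h1 h2]]]; exists (pt 0 (- a) + s *: d); split=> // i.
  by rewrite crossD crossZ.
have [e [e0 e_small]] : exists e, 0 < e /\ forall i j, i != j -> e < `|cross f (P i) - cross f (P j)|.
  have h i j : for_small (fun e : R => i != j -> e < `|cross f (P i) - cross f (P j)|).
    have [->|ij] := eqVneq i j; first by exists 1.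
    have : 0 < `|cross f (P i) - cross f (P j)| by rewrite normr_gt0 subr_eq0 x_sites.
    by move/(for_small_lt 1); apply: for_small_sub => s _; rewrite add0r mulr1.
  by have := for_small_forall (fun i => for_small_forall (h i)) => /for_small_ex[e [e0 he]]; exists e.
exists (generator_word P f g pt O e v), (std_loop P f g pt O e); split.
- by move=> w; exact: (std_loop_polyline x_pt y_pt O_below e0 e_small).
- by move=> w; exact: (closed_word_std_loop x_pt y_pt O_below e0 e_small v_neq0 ray_disjoint).
- by move=> s; exact: (polyline_std x_pt y_pt xy_inj x_sites O_below e0 e_small).
- by move=> u w; exact: (std_loop_conj x_pt y_pt O_below e0 e_small).
- move=> i; have [s [hs ls s0 es]] := exists_simple_loop v_neq0 ray_disjoint i rO.
  have [w hw] := loop_word x_pt y_pt xy_inj x_sites O_below e0 e_small v_neq0 ray_disjoint s0 hs ls.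
  by exists w; rewrite -hw es.
Qed.

Local Notation gp := (general_position (ray P v)).
Local Notation pw := (poincare_word P (ray P v)).

Lemma general_position_exists (s : seq point) : polyline_in N s ->
  exists l : polyline N, gp l /\ homotopic_seq N s (vertices l).
Proof.
move=> /(perturb_polyline v_neq0)[t [st rt]]; have [_ /polyline_of[l hl]] := homotopic_seq_polyline st.
exists l; split; first by move=> i A; rewrite (mem_vertices hl) => /rt; apply.
apply: homotopic_seq_trans st _; apply: homotopic_seq_cyc; last by rewrite -hl cyc_reprK.
by apply: polyline_cyc (polyline_vertices l); rewrite -hl cyc_reprK.
Qed.

Lemma mem_cyclic_pairs (T : eqType) (s : seq T) (e : T * T) :
  e \in cyclic_pairs s -> e.1 \in s /\ e.2 \in s.
Proof.
move=> he; split.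
  by have := map_f fst he; rewrite -/(unzip1 _) unzip1_zip // size_rot.
by have := map_f snd he; rewrite -/(unzip2 _) unzip2_zip ?size_rot // mem_rot.
Qed.

Lemma poincare_closed_word (l : polyline N) : gp l ->
  conj_words (cyc_repr (pw l)) (closed_word P v (vertices l)).
Proof.
move=> gl; have <- : seq_word P (ray P v) (vertices l) = closed_word P v (vertices l).
  congr flatten; apply/eq_in_map => -[A B] hAB; have [_ hl] := polyline_vertices l.
  have [/= hA hB] := mem_cyclic_pairs hAB.
  by apply: segment_cut_word => //; [move=> i; exact: gl|move=> i; exact: gl|exact: hl hAB].
by apply: conj_cyc; rewrite cyc_reprK.
Qed.

Lemma homotopic_vertices (l l' : polyline N) : homotopic_seq N (vertices l) (vertices l') -> homotopic l l'.
Proof.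
move=> [k [k' [hk hk' h]]].
have -> : l = k by apply: val_inj; rewrite hk cyc_reprK.
by have -> : l' = k' by apply: val_inj; rewrite hk' cyc_reprK.
Qed.

End Classification.

Theorem mainTheorem4 (R : realType) (n : nat) (n_ge1 : (1 <= n)%N)
    (P : 'I_n -> 'rV[R]_2) (P_inj : injective P)
    (r : 'I_n -> set 'rV[R]_2) (r_ray : forall i, is_ray (P i) (r i))
    (r_disjoint : forall i j, i != j -> r i `&` r j = set0) :
  exists Phi : homotopy_class (~` range P) -> cyclic (letter n),
    (forall (c : homotopy_class (~` range P)) (w : cyclic (letter n)),
       Phi c = w <->
       exists l : polyline (~` range P),
         [/\ class_of l = c, general_position r l
           & economical_form (poincare_word P r l) w]) /\
    set_bij [set: homotopy_class (~` range P)] (@economical_words n) Phi.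
Proof.
have [v hv] := choice r_ray.
have v_neq0 i : v i != 0 by case: (hv i).
have rE : r = ray P v by apply/funext => i; case: (hv i).
subst r.
have disj i j X : i != j -> ray P v i X -> ~ ray P v j X.
  by move=> ij iX jX; have := r_disjoint i j ij => /seteqP[/(_ X) h _]; apply: h.
have [phi [L [L_in L_word L_all L_conj phi_surj]]] := exists_generators P_inj v_neq0 disj.
have repr_exists (c : homotopy_class (~` range P)) : exists w : cyclic (letter n),
    exists l : polyline (~` range P), [/\ class_of l = c, general_position (ray P v) l
           & economical_form (poincare_word P (ray P v) l) w].
  have [l [gl hl]] := general_position_exists v_neq0 (polyline_vertices (generic_quotient.repr c)).
  have [w hw] := economical_form_exists (poincare_word P (ray P v) l).
  exists w, l; split=> //; rewrite -[RHS]reprK; apply/class_of_eqP.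
  by rewrite homotopic_sym; exact: homotopic_vertices.
have [Phi hPhi] := choice repr_exists.
have class_conj (l l' : polyline (~` range P)) : class_of l = class_of l' ->
    conj_words (closed_word P v (vertices l)) (closed_word P v (vertices l')).
  by move=> /class_of_eqP; exact: closed_word_homotopic.
have word_conj := @poincare_closed_word _ _ P v v_neq0 disj.
exists Phi; split.
  move=> c w; split=> [<-|[l [hl gl lw]]]; first exact: hPhi.
  have [l' [hl' gl' l'w]] := hPhi c; apply: economical_form_unique l'w lw.
  apply: conj_trans (word_conj _ gl') _; apply: conj_trans (conj_sym (word_conj _ gl)).
  by apply: class_conj; rewrite hl hl'.
split.
- by move=> c _; have [l [_ _ []]] := hPhi c.
- move=> c c' _ _ e.
  have [l [lc gl lw]] := hPhi c; have [l' [l'c gl' l'w]] := hPhi c'.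
  rewrite e in lw; rewrite -lc -l'c.
  apply/class_of_eqP/homotopic_vertices.
  (* Both lines are homotopic to standard loops. Their words are conjugate, and since the
     substitution reflects conjugacy, so are [u] and [u'], hence the loops are homotopic. *)
  have [u hu] := L_all _ (polyline_vertices l); have [u' hu'] := L_all _ (polyline_vertices l').
  apply: homotopic_seq_trans (hu) _; apply: homotopic_seq_trans (homotopic_seq_sym hu').
  apply/L_conj/(subst_conj_inj phi_surj); rewrite -!L_word.
  apply: conj_trans (conj_sym (homotopic_seq_closed_word v_neq0 disj hu)) _.
  apply: conj_trans (homotopic_seq_closed_word v_neq0 disj hu').
  apply: conj_trans (conj_sym (word_conj _ gl)) _; apply: conj_trans (word_conj _ gl').
  apply: conj_trans (economical_form_conj lw) _.
  exact/conj_sym/economical_form_conj.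
(* The prescribed word is lifted through [phi] to [u]; the standard loop of [u], moved off the rays,
   realizes it up to conjugacy. *)
- move=> w ew; have [u hu] := subst_surj phi_surj (cyc_repr w).
  have [l [gl hl]] := general_position_exists v_neq0 (L_in u).
  exists (class_of l) => //; have [l' [hl' gl' l'w]] := hPhi (class_of l).
  apply: (economical_form_unique _ l'w); last by split; [exists [::] | exact: ew].
  apply: conj_trans (word_conj _ gl') _; apply: conj_trans (class_conj _ _ hl') _.
  apply: conj_trans (conj_sym (homotopic_seq_closed_word v_neq0 disj hl)) _.
  by rewrite L_word; exact: conj_red.
Qed.
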